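(* Let $m\geq 3$ and let $\chi_1,\chi_2$ be multiplicative characters modulo $2^m$ with $\chi_2$ primitive. Let $A,B,k$ be integers with $k\geq 1$, $A$ even and $B$ odd, and write $$A=2^nA_1,\ n>0,\qquad k=2^tk_1,\qquad 2\nmid A_1k_1B,$$ and set $$S=\sum_{x=1}^{2^m}\chi_1(x)\chi_2(Ax^k+B).$$ Let $c_1,c_2$ be the integers with $\chi_i(5)=e_{2^{m-2}}(c_i)$ and $1\leq c_i\leq 2^{m-2}$ ($i=1,2$), where $e_q(x)=e^{2\pi i x/q}$. For $i\geq 2$ let $R_i$ be the odd integer defined by $5^{2^{i-2}}=1+R_i2^i$. Define $$N:=\begin{cases}\lceil \tfrac12(m-n)\rceil, & \text{if } m-n>2t+4,\\ t+2, & \text{if } t+2\leq m-n\leq 2t+4,\end{cases}$$ and $$C(x):=c_1(Ax^k+B)+c_2Akx^kR_NR_{N+n}^{-1},$$ where $R_{N+n}^{-1}$ denotes the inverse of $R_{N+n}$ modulo $2^m$. By the characteristic equation we mean the congruence $$C(x_0)\equiv 0 \pmod{2^{\lfloor \frac12(m+n)\rfloor+t}}$$ in an integer $x_0$ with $2\nmid x_0(Ax_0^k+B)$. Suppose that $m-n\geq t+2$. Then $S=0$ unless all of the following hold: $c_1=2^{n+t}c_3$ with $c_3$ an odd integer; $\chi_1(-1)=1$ if $k$ is even; and, when $m-n>2t+4$, the characteristic equation has an odd solution $x_0$. Assume these conditions hold. Then: (i) If $m-n>2t+4$, let $x_0$ be an odd solution of the characteristic equation, write $C(x_0)=\lambda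 2^{\lfloor\frac12(m+n)\rfloor+t}$ with $\lambda\in\mathbb Z$, and put $h:=2\lambda+(k_1-1)+(2^n-1)c_3$. Then $$S=2^{\frac12(m+n)+t+\min\{1,t\}}\chi_1(x_0)\chi_2(Ax_0^k+B)\cdot\begin{cases}1, & \text{if } m-n \text{ is even},\\ \omega^h\left(\frac{2}{h}\right), & \text{if } m-n \text{ is odd},\end{cases}$$ where $\omega=e^{\pi i/4}$ and $\left(\frac{2}{h}\right)$ is the Jacobi symbol. (ii) If $t+3<m-n\leq 2t+4$, then $$S=\begin{cases}2^{m-1}\chi_2(A+B), & \text{if } k \text{ is even and } C(1)\equiv 0 \bmod 2^{m-2},\\ 2^{m-2}\chi_2(A+B), & \text{if } k \text{ is odd and } C(1)\equiv 0 \bmod 2^{m-2},\\ 2^{m-2}\chi_1(-1)\chi_2(-A+B), & \text{if } k \text{ is odd and } C(-1)\equiv 0 \bmod 2^{m-2},\\ 0, & \text{otherwise}.\end{cases}$$ (iii) If $m-n=t+3$, then $$S=\begin{cases}2^{m-1}\chi_2(A+B), & \text{if } k \text{ is even and } \chi_1(5)=\pm1,\ \chi_1(-1)=1,\\ 2^{m-2}\bigl(\chi_2(A+B)+\chi_1(-1)\chi_2(-A+B)\bigr), & \text{if } k \text{ is odd and } \chi_1(5)=\pm 1,\\ 0, & \text{otherwise}.\end{cases}$$ (iv) If $m-n=t+2$, then $$S=\begin{cases}2^{m-1}\chi_2(A+B), & \text{if } k \text{ is even and } \chi_1=\chi_0, \text{ or } k \text{ is odd and } \chi_1=\chi_4,\\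 0, & \text{otherwise},\end{cases}$$ where $\chi_0$ is the principal character modulo $2^m$ and $\chi_4$ is the character modulo $2^m$ induced by the non-trivial character modulo $4$ (i.e. $\chi_4(x)=\pm1$ according as $x\equiv\pm1 \bmod 4$).
   Context: Characters modulo $2^m$ are extended by $\chi(x)=0$ for even $x$. Since $(\mathbb Z/2^m\mathbb Z)^*$ is generated by $-1$ and $5$, with $5$ of order $2^{m-2}$, each character mod $2^m$ is determined by its values at $-1$ and $5$; primitivity of $\chi_2$ means $c_2$ is odd. Throughout, $y^{-1}$ denotes the inverse of an odd integer $y$ modulo $2^m$. *)

(* Defs.v *)
From mathcomp Require Import all_boot all_order all_algebra.
From mathcomp Require Import reals trigo.
From mathcomp Require Import complex.
Set Implicit Arguments.
Unset Strict Implicit.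
Unset Printing Implicit Defensive.
Import GRing.Theory Num.Theory.
Local Open Scope ring_scope.

Definition expi (R : realType) (x : R) : R[i] := (cos x +i* sin x)%C.

Definition e_ (R : realType) (q : nat) (x : int) : R[i] :=
  expi (2 * pi * x%:~R / q%:R).

Definition omega (R : realType) : R[i] := expi (pi / 4).

Definition is_char_mod2 (R : realType) (m : nat) (chi : int -> R[i]) : Prop :=
  [/\ (forall x y : int, (x == y %[mod (2 ^+ m)])%Z -> chi x = chi y),
      (forall x y : int, chi (x * y) = chi x * chi y),
      chi 1 = 1 &
      (forall x : int, (2 %| x)%Z -> chi x = 0)].

(* Primitive: not induced by a character modulo 2^(m-1), i.e. not periodic
   modulo 2^(m-1). *)
Definition primitive_char2 (R : realType) (m : nat) (chi : int -> R[i]) : Prop :=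
  ~ (forall x y : int, (x == y %[mod (2 ^+ (m.-1))])%Z -> chi x = chi y).

Definition chi0 (R : realType) (x : int) : R[i] :=
  if (2 %| x)%Z then 0 else 1.

Definition chi4 (R : realType) (x : int) : R[i] :=
  if (2 %| x)%Z then 0 else if (x == 1 %[mod 4])%Z then 1 else -1.

Definition Rseq (i : nat) : int := ((5 ^+ (2 ^ (i - 2)) - 1) %/ 2 ^+ i)%Z.

Definition Nval (m n t : nat) : nat :=
  if (2 * t + 4 < m - n)%N then uphalf (m - n) else (t + 2)%N.

(* C(x) = c1 (A x^k + B) + c2 A k x^k R_N R_{N+n}^{-1},
   where Rinv is (a representative of) the inverse of R_{N+n} mod 2^m. *)
Definition Cfun (m n t k : nat) (A B c1 c2 Rinv : int) (x : int) : int :=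
  c1 * (A * x ^+ k + B) + c2 * A * k%:Z * x ^+ k * Rseq (Nval m n t) * Rinv.

Definition Ssum (R : realType) (m k : nat) (chi1 chi2 : int -> R[i]) (A B : int)
  : R[i] :=
  \sum_(1 <= x < (2 ^ m).+1) chi1 x%:Z * chi2 (A * x%:Z ^+ k + B).

Definition legendre (a : int) (p : nat) : int :=
  if (p%:Z %| a)%Z then 0
  else if [exists x : 'I_p, (x%:Z ^+ 2 == a %[mod p%:Z])%Z] then 1 else -1.

Definition jacobi (a n : int) : int :=
  \prod_(p <- primes `|n|%N) legendre a p ^+ logn p `|n|%N.

(* Main.v *)
Require Import Defs.
From mathcomp Require Import all_boot all_order all_algebra.
From mathcomp Require Import all_fingroup all_solvable all_field.
From mathcomp Require Import zify ring lra.
From mathcomp Require Import reals trigo.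
From mathcomp Require Import complex.
Set Implicit Arguments.
Unset Strict Implicit.
Unset Printing Implicit Defensive.
Import Order.TTheory GRing.Theory Num.Theory.
Local Open Scope ring_scope.

(* Write [f x = chi1 x * chi2 (A x^k + B)] and [N = J + t + 2],
   [m = n + N + d].  Multiplying [x] by [g = 5^(2^(m-n-t-2))], or by [-1] when
   [k] is even, leaves [A x^k] unchanged modulo [2^m]; hence [S = 0] unless
   [chi1 g = 1], i.e. [2^(n+t)] divides [c1], and [chi1 (-1) = 1] for even [k].
   Once [c1 = 2^(n+t) c3], so that [C = 2^(n+t) cc], the inequality [m <= 2(n+N)]
   makes the binomial expansions of powers of 5 linear, and
     f (x 5^(2^J u)) = f x * e_(2^d) (u y' cc x),   y' = (A x^k + B)^-1.
   Averaging over [u] modulo [2^d] keeps only the [x] with [2^d | cc x], which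
   is the characteristic equation.  Since [cc (x 5^w) - cc x] has the 2-adic
   valuation of [5^(k w) - 1], the solutions up to powers of [5^(2^J)] are
   explicit: they lie in [{1, -1}] when [J = 0]; otherwise they are [x0] alone
   if [m - n] is even, or [x0] and [x0 5^(2^(J-1))] if [m - n] is odd, together
   with their opposites when [k] is even.  In the case of two solutions a second
   order expansion shows that the ratio of the values of [f] is [i^h], and
   [1 + i^h = sqrt 2 * omega^h * (2/h)]. *)

(** * Odd integers and divisibility by powers of 2 *)

Definition oddz (x : int) : bool := ~~ (2 %| x)%Z.

Lemma oddzP (x : int) : reflect (exists a, x = 2 * a + 1) (oddz x).
Proof.
rewrite /oddz; apply: (iffP idP) => [xodd | [a ->]]; last by lia.
by exists (x %/ 2)%Z; lia.
Qed.

Lemma oddzM (x y : int) : oddz (x * y) = oddz x && oddz y.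
Proof. by rewrite /oddz !dvdzE abszM Euclid_dvdM // negb_or. Qed.

Lemma oddzX (x : int) (n : nat) : oddz x -> oddz (x ^+ n).
Proof. by move=> x_odd; elim: n => // n IHn; rewrite exprS oddzM x_odd. Qed.

Lemma oddz_natE (k : nat) : oddz k%:Z = odd k.
Proof. by rewrite /oddz dvdzE /= dvdn2 negbK. Qed.

Lemma dvd2_exp (n : nat) : (0 < n)%N -> (2 %| 2 ^+ n)%Z.
Proof. by case: n => // n _; rewrite exprS dvdz_mulr. Qed.

Lemma pow2_neq0 (j : nat) : (2 ^+ j : int) != 0.
Proof. exact: expf_neq0. Qed.

Lemma PoszX2 (j : nat) : (2 ^ j)%N%:Z = 2 ^+ j.
Proof. by elim: j => // j IHj; rewrite expnS PoszM IHj exprS. Qed.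

Lemma dvdz_subC (d x y : int) : (d %| x - y)%Z = (d %| y - x)%Z.
Proof. by rewrite -opprB !dvdzE abszN. Qed.

Lemma dvdz_pow2_oddl (j : nat) (c x : int) :
  oddz c -> (2 ^+ j %| c * x)%Z = (2 ^+ j %| x)%Z.
Proof.
move=> c_odd; apply: Gauss_dvdzr; apply: coprimezXl.
by rewrite coprimezE prime_coprime // -dvdzE.
Qed.

Lemma dvdz_pow2_le (i j : nat) (x : int) :
  (i <= j)%N -> (2 ^+ j %| x)%Z -> (2 ^+ i %| x)%Z.
Proof. by move=> le_ij; apply: dvdz_trans; exact: dvdz_exp2l. Qed.

Lemma dvdz_pow2_shift (i j : nat) (x : int) :
  (2 ^+ (i + j) %| 2 ^+ i * x)%Z = (2 ^+ j %| x)%Z.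
Proof. by rewrite exprD dvdz_mul2l // pow2_neq0. Qed.

Lemma oddz_inv (m : nat) (y : int) :
  oddz y -> exists y', (2 ^+ m %| y * y' - 1)%Z.
Proof.
move=> y_odd; have: coprimez y (2 ^+ m).
  by apply: coprimezXr; rewrite coprimez_sym coprimezE prime_coprime // -dvdzE.
case/coprimezP=> -[u v] /= uv1; exists u; apply/dvdzP; exists (- v).
by rewrite mulrC -(addrK (v * 2 ^+ m) (u * y)) uv1; ring.
Qed.

(** * Binomial expansions, powers of 5 and the numbers [Rseq] *)

Lemma expr1D_mod2 (a : int) (p : nat) :
  exists q, (1 + a) ^+ p = 1 + p%:Z * a + a ^+ 2 * q.
Proof.
elim: p => [|p [q IHp]]; first by exists 0; rewrite expr0; ring.
by exists (q + p%:Z + a * q); rewrite exprS IHp intS; ring.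
Qed.

(** The quadratic term is needed in [f_half_step], where the modulus is one factor 2 too large for
    the linear expansion. *)
Lemma expr1D_mod3 (a : int) (p : nat) :
  exists q, (1 + a) ^+ p = 1 + p%:Z * a + 'C(p, 2)%:Z * a ^+ 2 + a ^+ 3 * q.
Proof.
elim: p => [|p [q IHp]]; first by exists 0; rewrite expr0 bin0n /=; ring.
exists (q + 'C(p, 2)%:Z + a * q).
by rewrite exprS IHp intS binS bin1 PoszD; ring.
Qed.

Lemma pow5_dvd (i : nat) : (2 ^+ i.+2 %| 5 ^+ (2 ^ i) - 1)%Z.
Proof.
elim: i => [|i /dvdzP[q Eq]]; first by [].
apply/dvdzP; exists (q + 2 ^+ i.+1 * q ^+ 2).
rewrite expnS mulnC exprM -[5 ^+ _](subrK 1) Eq !exprS; ring.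
Qed.

Lemma RseqE (i : nat) :
  (1 < i)%N -> 5 ^+ (2 ^ (i - 2)) = 1 + Rseq i * 2 ^+ i :> int.
Proof.
move=> i_gt1; rewrite /Rseq divzK ?[1 + _]addrC ?subrK //.
by case: i i_gt1 => [|[|i]] // _; rewrite subn2; exact: pow5_dvd.
Qed.

(** Squaring [1 + R_i 2^i] gives [1 + 2^(i+1) (R_i + 2^(i-1) R_i^2)]. *)
Lemma RseqS (i : nat) :
  (1 < i)%N -> Rseq i.+1 = Rseq i + 2 ^+ i.-1 * Rseq i ^+ 2.
Proof.
case: i => [//|[//|i]] _; apply: (mulIf (pow2_neq0 i.+3)); apply: (addrI 1).
rewrite -RseqE // subn2 /= expnS mulnC exprM.
have := RseqE (isT : (1 < i.+2)%N); rewrite subn2 /= => ->.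
by rewrite !exprS; ring.
Qed.


Lemma oddz_Rseq (i : nat) : (1 < i)%N -> oddz (Rseq i).
Proof.
elim: i => // -[//|[//|i]] IHi _; rewrite RseqS //.
have /oddzP[a ->] := IHi isT.
by rewrite /oddz /= exprS; lia.
Qed.

(** The recursion starts from [R_3 = 3], and from there on its correction [2^(i-1) R_i^2] is
    divisible by 4. This lets [half_step_exponent] replace [R_N] by [-1] modulo 4. *)
Lemma Rseq_mod4 (i : nat) : (2 < i)%N -> (4 %| Rseq i + 1)%Z.
Proof.
elim: i => // -[//|[//|[//|i]]] IHi _; rewrite RseqS //.
by have := IHi isT; rewrite /= !exprS; lia.
Qed.

(** For [w = 2^i a] with [a] odd, expanding [(1 + R_(i+2) 2^(i+2))^a] shows that [5^w - 1] is
    [2^(i+2)] times an odd number. *)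
Lemma pow5_dvdE (j w : nat) : (2 ^+ j.+2 %| 5 ^+ w - 1)%Z = (2 ^ j %| w)%N.
Proof.
case: (posnP w) => [-> | w_gt0]; first by rewrite expr0 subrr dvdz0 dvdn0.
case: (pfactor_coprime (isT : prime 2) w_gt0) => a; rewrite coprime2n => a_odd.
rewrite mulnC => wE; 
have -> : (2 ^ j %| w)%N = (j <= logn 2 w)%N by rewrite pfactor_dvdn.
rewrite [in LHS]wE; set i := logn 2 w; clearbody i; clear w w_gt0 wE.
have Ei := RseqE (isT : (1 < i.+2)%N); rewrite subn2 /= in Ei.
have [q Eq] : exists q, 5 ^+ (2 ^ i * a) - 1 = 2 ^+ i.+2 * q :> int /\ oddz q.
  have [q0 Eq0] := expr1D_mod2 (Rseq i.+2 * 2 ^+ i.+2) a.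
  exists (Rseq i.+2 * (a%:Z + 2 * (Rseq i.+2 * 2 ^+ i.+1 * q0))).
  split; first by rewrite exprM Ei Eq0 !exprS; ring.
  rewrite oddzM oddz_Rseq //= /oddz; move: a_odd; clear; lia.
case: Eq => -> /oddzP q_odd.
apply/idP/idP => [|le_ji]; last by rewrite dvdz_mulr // dvdz_exp2l // !ltnS.
move: q_odd => /oddzP q_odd; rewrite mulrC dvdz_pow2_oddl //.
by rewrite dvdz_Pexp2l // !ltnS.
Qed.

Lemma pow5_dvdE2 (m w : nat) :
  (1 < m)%N -> (2 ^+ m %| 5 ^+ w - 1)%Z = (2 ^ (m - 2) %| w)%N.
Proof. by case: m => [|[|m]] // _; rewrite pow5_dvdE subn2. Qed.

(** * The quadratic character of 2 and the Jacobi symbol *)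

(* The quadratic character of 2 is computed in the field with p^2 elements,
   where 2 = (z + z^-1)^2 for a primitive 8th root of unity z. *)
Lemma pow8_root (F : finFieldType) :
  (8 %| #|F|.-1)%N -> exists z : F, z ^+ 4 = -1.
Proof.
move=> dvd8.
have /cyclicP[g gE] := field_unit_group_cyclic [set: {unit F}]%G.
have og : #[g]%g = #|F|.-1 by rewrite /order -gE /= card_finField_unit.
have og_gt0 : (0 < #|F|.-1)%N by rewrite -og order_gt0.
have := order_gt0 g.
pose u := (g ^+ (#|F|.-1 %/ 8))%g; exists (val u).
have ou : #[u]%g = 8.
  by rewrite orderXdiv ?og ?dvdn_div // divnA // mulKn.
have u8 : (val u ^+ 4) ^+ 2 = 1 :> F.
  by rewrite -exprM -FinRing.val_unitX; have := expg_order u; rewrite ou => ->.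
have u4 : val u ^+ 4 != 1 :> F.
  rewrite -FinRing.val_unitX -FinRing.val_unit1 (inj_eq val_inj).
  by rewrite -order_dvdn ou.
by move/eqP: u8; rewrite sqrf_eq1 (negPf u4) => /eqP.
Qed.

Lemma legendre2 (p : nat) : prime p -> odd p ->
  legendre 2 p = if (p %% 8 \in [:: 1; 7])%N then 1 else -1.
Proof.
move=> p_pr p_odd; have p_gt1 := prime_gt1 p_pr; have p_gt0 := ltnW p_gt1.
have p_gt2 : (2 < p)%N by case: p p_odd p_gt1 {p_pr p_gt0} => [|[|[|]]].
have [F pcharF cardF] := pPrimePowerField p_pr (isT : (0 < 2)%N).
have [z z4] : exists z : F, z ^+ 4 = -1.
  (* The order [p^2 - 1] of the unit group is divisible by 8, as [p] is odd. *)
  apply: pow8_root; rewrite cardF -subn1 -eqn_mod_dvd ?expn_gt0 ?p_gt0 // -modnXm.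
  have : (p %% 8 \in [:: 1; 3; 5; 7])%N by rewrite !inE; move: p_odd; clear; lia.
  by rewrite !inE => /or4P[]/eqP->.
have z0 : z != 0.
  by apply: contra_eq_neq z4 => ->; rewrite expr0n /= eq_sym oppr_eq0 oner_eq0.
have z8 : z ^+ 8 = 1 by rewrite (exprM z 4 2) z4 sqrrN expr1n.
have natF0 a : (a%:R == 0 :> F) = (p %| a)%N by rewrite (dvdn_pcharf pcharF).
have two_neq0 : 2 != 0 :> F.
  by rewrite natF0 gtnNdvd.
pose tau : F := z + z^-1.
have tau2 : tau ^+ 2 = 2.
  have : z ^+ 2 + z ^- 2 = 0.
    apply: (mulIf (expf_neq0 2 z0)); rewrite mul0r mulrDl mulVf ?expf_neq0 //.
    by rewrite -exprD z4 addNr.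
  by rewrite /tau sqrrD -exprVn mulfV // => e; rewrite addrAC e add0r.
have tau_neq0 : tau != 0.
  by apply: contraNneq two_neq0 => t0; rewrite -tau2 t0 expr0n.
have tauX : tau ^+ p = z ^+ p + (z ^+ p)^-1.
  by rewrite -(pFrobenius_autE pcharF) rmorphD fmorphV /= !pFrobenius_autE.
have zX : z ^+ p = z ^+ (p %% 8)
  by rewrite {1}(divn_eq p 8) exprD mulnC exprM z8 expr1n mul1r.
(* By Frobenius [tau^p = z^p + z^-p], which depends only on [p] modulo 8; since [z^4 = -1], it is
   [tau] for [p = 1, 7] and [- tau] for [p = 3, 5]. *)
have tau_sq : tau ^+ p = if (p %% 8 \in [:: 1; 7])%N then tau else - tau.
  have : (p %% 8 \in [:: 1; 3; 5; 7])%N.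
    rewrite !inE; move: p_odd; clear; lia.
  have zV : z^-1 = z ^+ 7 by apply: (mulfI z0); rewrite mulfV // -exprS z8.
  rewrite tauX zX !inE => /or4P[]/eqP->; rewrite /= /tau -?exprVn zV.
  - by rewrite !expr1.
  - ring: z4.
  - ring: z4.
  ring: z4.
(* The fixed points of Frobenius form the prime field: its [p] elements are already all the roots
   that [X^p - X] can have. *)
have fixF (x : F) : x ^+ p = x -> exists a : 'I_p, x = a%:R.
  move=> xp; pose r := [seq (a%:R : F) | a <- iota 0 p].
  have r_uniq : uniq r.
    rewrite map_inj_in_uniq ?iota_uniq // => a b; rewrite !mem_iota !add0n /=.
    wlog le_ab : a b / (a <= b)%N.
      by move=> W la lb ab; case/orP: (leq_total a b) => ?; [|symmetry]; apply: W.
    move=> la lb /eqP; rewrite eq_sym -subr_eq0 -natrB // natF0 => dvd_ba.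
    have: (b - a < p)%N by apply: leq_ltn_trans lb; exact: leq_subr.
    case: (posnP (b - a)) => [/eqP|ba_gt0]; last first.
      by move/dvdn_leq: dvd_ba => /(_ ba_gt0); lia.
    by move: le_ab; clear; lia.
  pose P : {poly F} := 'X^p - 'X.
  have sizeP : size P = p.+1.
    by rewrite size_polyDl size_polyXn // size_polyN size_polyX.
  have P0 : P != 0 by rewrite -size_poly_eq0 sizeP.
  have rootP y : root P y = (y ^+ p == y).
    by rewrite /root !hornerE subr_eq0.
  have r_root : all (root P) r.
    apply/allP=> _ /mapP[a _ ->]; rewrite rootP -(pFrobenius_autE pcharF).
    by rewrite rmorph_nat.
  have : x \in r.
    apply: contraTT isT => xr.
    have := max_poly_roots P0 (rs := x :: r); rewrite /= rootP xp eqxx r_root xr r_uniq.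
    by rewrite size_map size_iota sizeP ltnn => /(_ isT isT).
  case/mapP=> a; rewrite mem_iota add0n /= => lt_a ->.
  by exists (Ordinal lt_a).
have sqE (a : nat) : (a%:Z ^+ 2 == 2 %[mod p%:Z])%Z = ((a%:R : F) ^+ 2 == 2).
  rewrite eqz_mod_dvd (dvdz_pcharf pcharF) rmorphB rmorphXn /=.
  by rewrite -!pmulrn subr_eq0.
rewrite /legendre ifF; last first.
  by apply/negbTE; move: two_neq0; rewrite natF0 dvdzE.
(* 2 is a square modulo [p] exactly when its square root [tau] lies in the prime field, that is,
   when [tau^p = tau]. *)
case: ifP tau_sq => _ tau_sq; case: ifP => // /existsP H; exfalso.
  apply: H; have [a tauE] := fixF _ tau_sq; exists a.
  by rewrite sqE -tauE tau2.
have [a] := H; rewrite sqE -tau2 eqf_sqr => aE.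
have aX : (a%:R : F) ^+ p = a%:R by rewrite -(pFrobenius_autE pcharF) rmorph_nat.
have tauE : tau ^+ p = tau.
  case/orP: aE => /eqP E; first by rewrite -E.
  have -> : tau = - a%:R by rewrite E opprK.
  by rewrite exprNn aX -signr_odd p_odd expr1 mulN1r.
have : tau *+ 2 == 0 by rewrite mulr2n -{1}tauE tau_sq addNr.
by rewrite -mulr_natl mulf_eq0 (negPf two_neq0) (negPf tau_neq0).
Qed.

(** The right-hand side, [psi], is multiplicative on odd numbers, so the formula passes from the
    prime factors to their product. *)
Lemma jacobi2 (h : int) : odd `|h|%N ->
  jacobi 2 h = if (`|h| %% 8 \in [:: 1; 7])%N then 1 else -1.
Proof.
rewrite /jacobi; move: `|h|%N => {h} n n_odd.
pose psi a : int := if (a %% 8 \in [:: 1; 7])%N then 1 else -1.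
have psiM a b : odd a -> odd b -> psi (a * b)%N = psi a * psi b.
  have od a0 : odd a0 -> (a0 %% 8 \in [:: 1; 3; 5; 7])%N.
    rewrite !inE; clear; lia.
  move=> /od a8 /od b8; rewrite /psi -modnMm; move: a8 b8; rewrite !inE.
  by do 2!case/or4P=> /eqP->.
have psiX a e : odd a -> psi (a ^ e)%N = psi a ^+ e.
  move=> a_odd; elim: e => // e IHe; rewrite expnS psiM ?IHe ?exprS //.
  by rewrite oddX a_odd orbT.
have n_gt0 : (0 < n)%N by case: n n_odd.
transitivity (psi (\prod_(p <- primes n) p ^ logn p n)%N); last first.
  by rewrite [in RHS](prod_prime_decomp n_gt0) prime_decompE big_map.
have pr_odd p : p \in primes n -> prime p && odd p.
  rewrite mem_primes => /and3P[-> _ /dvdnP[c nE]]; move: n_odd.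
  by rewrite nE oddM => /andP[].
elim: (primes n) pr_odd => [|p s IHs] pr_odd; first by rewrite !big_nil.
have /andP[p_pr p_odd] := pr_odd p (mem_head _ _).
have IH := IHs (fun q qs => pr_odd q (mem_behead (s := p :: s) qs)).
rewrite !big_cons IH psiM ?psiX ?oddX ?p_odd ?orbT // ?legendre2 //.
rewrite big_seq; elim/big_ind: _ => // [a b|q qs]; first by rewrite oddM => -> ->.
by have /andP[_ q_odd] := pr_odd q (mem_behead (s := p :: s) qs); rewrite oddX q_odd orbT.
Qed.

(** * Additive characters and eighth roots of unity *)

Section AdditiveCharacter.
Variable R : realType.

Lemma expiD (x y : R) : expi (x + y) = expi x * expi y.
Proof.
rewrite /expi cosD sinD; apply/eqP; rewrite eq_complex /=.
by rewrite eqxx /= addrC.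
Qed.

Lemma e_D (q : nat) (x y : int) : e_ R q (x + y) = e_ R q x * e_ R q y.
Proof. by rewrite /e_ rmorphD /= mulrDr mulrDl expiD. Qed.

Lemma e_0 (q : nat) : e_ R q 0 = 1.
Proof. by rewrite /e_ mulr0 mul0r /expi cos0 sin0. Qed.

Lemma e_neq0 (q : nat) (x : int) : e_ R q x != 0.
Proof.
apply/eqP=> e0; have := e_D q x (- x).
by rewrite subrr e_0 e0 mul0r => /eqP; rewrite oner_eq0.
Qed.

Lemma e_M (q : nat) (x : int) (u : nat) : e_ R q (x * u%:Z) = e_ R q x ^+ u.
Proof.
elim: u => [|u IHu]; first by rewrite mulr0 e_0 expr0.
by rewrite intS mulrDr mulr1 e_D IHu exprS.
Qed.

Lemma e_exprz (q : nat) (h : int) : e_ R q h = e_ R q 1 ^ h.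
Proof.
case: h => h; first by rewrite -[in LHS](mul1r (Posz h)) e_M.
rewrite NegzE -exprnN -[e_ R q 1 ^+ _]e_M mul1r.
apply: (mulfI (e_neq0 q h.+1%:Z)).
by rewrite -e_D subrr e_0 mulfV ?e_neq0.
Qed.

Lemma e_full (q : nat) : (0 < q)%N -> e_ R q q%:Z = 1.
Proof.
move=> q_gt0; rewrite /e_ mulfK ?pnatr_eq0 -?lt0n //.
have -> : 2 * pi = 0 + pi *+ 2 :> R by rewrite add0r mulr_natl.
by rewrite /expi sinD2pi cosD2pi cos0 sin0.
Qed.

Lemma e_dvd (q : nat) (x : int) : (0 < q)%N -> (q %| x)%Z -> e_ R q x = 1.
Proof.
move=> q_gt0 /dvdzP[a ->]; rewrite mulrC e_exprz.
by rewrite -exprz_exp -e_exprz e_full // exp1rz.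
Qed.

Lemma e_congr (q : nat) (x y : int) :
  (0 < q)%N -> (q %| x - y)%Z -> e_ R q x = e_ R q y.
Proof.
by move=> q_gt0 xy; rewrite -[x](subrK y) e_D (e_dvd _ xy) // mul1r.
Qed.

Lemma e_scale (q a : nat) (x : int) :
  (0 < a)%N -> e_ R (a * q) (a%:Z * x) = e_ R q x.
Proof.
move=> a_gt0; rewrite /e_ rmorphM /= natrM; congr expi.
by rewrite mulrCA -mulf_div mulfV ?mul1r // pnatr_eq0 -lt0n.
Qed.

Lemma e_scale2 (l d : nat) (x : int) :
  (d <= l)%N -> e_ R (2 ^ l) (2 ^+ (l - d) * x) = e_ R (2 ^ d) x.
Proof.
move=> le_dl; rewrite -{1}(subnK le_dl) expnD.
by rewrite -PoszX2 e_scale // expn_gt0.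
Qed.

Lemma e_2 (x : int) : e_ R 2 x = if (2 %| x)%Z then 1 else -1.
Proof.
have [x_even | /oddzP[a ->]] := ifP; first exact: e_dvd.
rewrite e_D e_dvd ?dvdz_mulr // mul1r /e_ mulr1 [2 * _]mulrC mulfK ?pnatr_eq0 //.
by rewrite /expi cospi sinpi; apply/eqP; rewrite eq_complex /= oppr0 !eqxx.
Qed.

(** Induction on [l]: squaring gives [2^l | x] from the previous level, and for [x = 2^l y] the
    value at level [l + 1] is [e_2(y)], which is 1 only for even [y]. *)
Lemma e_pow2_eq1 (l : nat) (x : int) :
  (e_ R (2 ^ l) x == 1) = (2 ^+ l %| x)%Z.
Proof.
apply/eqP/idP=> [|lx]; last first.
  by rewrite e_dvd ?expn_gt0 // PoszX2.
elim: l x => [|l IHl] x ex1; first by rewrite expr0 dvd1z.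
have : (2 ^+ l %| x)%Z.
  by apply: IHl; rewrite -(e_scale2 _ (leqnSn l)) subSnn mulrC e_M ex1 expr1n.
case/dvdzP=> y xE; rewrite xE mulrC exprSr dvdz_mul2l ?pow2_neq0 //.
have := e_scale2 y (isT : (1 <= l.+1)%N); rewrite subn1 /= [_ * y]mulrC -xE ex1.
rewrite e_2; case: ifP => // _ /eqP; rewrite eq_sym eqNr.
by rewrite oner_eq0.
Qed.

(** A geometric sum whose ratio is a [2^d]-th root of unity. *)
Lemma sum_e_pow2 (d : nat) (x : int) :
  \sum_(0 <= u < 2 ^ d) e_ R (2 ^ d) (x * u%:Z)
  = if (2 ^+ d %| x)%Z then (2 ^+ d) else 0.
Proof.
under eq_bigr do rewrite e_M.
rewrite -e_pow2_eq1; have [-> | ex1] := eqVneq.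
  under eq_bigr do rewrite expr1n.
  by rewrite sumr_const_nat subn0 natrX.
have := subrX1 (e_ R (2 ^ d) x) (2 ^ d); rewrite -e_M e_dvd ?dvdz_mull ?expn_gt0 //.
rewrite subrr -(big_mkord xpredT (fun u => e_ R (2 ^ d) x ^+ u)) =>
  /esym/eqP; rewrite mulf_eq0 subr_eq0 (negPf ex1).
by move/eqP.
Qed.

Lemma omegaE : omega R = e_ R 8 1.
Proof.
by rewrite /omega /e_ mulr1; congr expi; field.
Qed.

(** Both sides are [1 + i], because the sine and cosine of [pi / 4] are [1 / sqrt 2]. *)
Lemma sqrt2_omega : (Num.sqrt (2 : R))%:C%C * omega R = 1 + e_ R 4 1.
Proof.
have sc : sin (pi / 4) = cos (pi / 4) :> R.
  rewrite -cosBpihalf -cosN opprB [pi / 2]splitr -mulrA -invfM -natrM.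
  by rewrite addrK.
have s2 : cos (pi / 4) ^+ 2 *+ 2 = 1 :> R.
  by rewrite mulr2n -{2}sc cos2Dsin2.
have c_gt0 : 0 < cos (pi / 4) :> R.
  apply: cos_gt0_pihalf; have := pi_gt0 R; set p := pi => p_gt0.
  by apply/andP; split; lra.
have sq : Num.sqrt 2 * cos (pi / 4) = 1 :> R.
  apply/eqP; rewrite -(@eqrXn2 _ 2) ?mulr_ge0 ?sqrtr_ge0 ?ltW //.
  by rewrite exprMn sqr_sqrtr ?ler0n // mulr_natl s2 expr1n.
have -> : e_ R 4 1 = (0 +i* 1)%C.
  rewrite /e_ mulr1 (_ : 2 * pi / 4%:R = pi / 2) ?/expi ?cos_pihalf ?sin_pihalf //.
  by field.
apply/eqP; rewrite eq_complex /omega /expi /= sc sq.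
by rewrite !mul0r subr0 !addr0 add0r !eqxx.
Qed.

(** All terms depend only on [h] modulo 8. The class 1 is [sqrt2_omega]; the classes 3, 5, 7 follow
    from it by multiplying with powers of [omega] and using [omega^4 = -1]. *)
Lemma omega_jacobi (h : int) : oddz h ->
  (Num.sqrt (2 : R))%:C%C * (omega R ^ h * (jacobi 2 h)%:~R) = 1 + e_ R 4 h.
Proof.
move=> h_odd; have h_abs : odd `|h|%N by move: h_odd; rewrite /oddz; lia.
rewrite mulrA; set s := (_)%:C%C.
have E4 x : e_ R 4 x = e_ R 8 (2 * x).
  by rewrite -(e_scale 4 x (isT : (0 < 2)%N)).
have E8 x y : (8 %| x - y)%Z -> e_ R 8 x = e_ R 8 y by exact: e_congr.
have e84 : e_ R 8 4 = e_ R 2 1 := e_scale 2 1 (isT : (0 < 4)%N).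
have w4 : omega R ^+ 4 = -1.
  by rewrite omegaE -e_M mul1r e84 e_2.
have sw := sqrt2_omega; rewrite -/s E4 mulr1 in sw.
have wn (j : nat) : e_ R 8 j%:Z = omega R ^+ j by rewrite omegaE -e_M mul1r.
rewrite (wn 2%N) in sw.
rewrite jacobi2 // E4 {1}omegaE -e_exprz.
have cases : [\/ (8 %| h - 1)%Z, (8 %| h - 3)%Z, (8 %| h - 5)%Z | (8 %| h - 7)%Z].
  have : [|| (8 %| h - 1)%Z, (8 %| h - 3)%Z, (8 %| h - 5)%Z | (8 %| h - 7)%Z].
    by move: h_odd; rewrite /oddz; lia.
  by case/or4P; [constructor 1|constructor 2|constructor 3|constructor 4].
have key (j : nat) (b : bool) : (8 %| h - j%:Z)%Z ->
    (`|h| %% 8 \in [:: 1; 7])%N = b ->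
    s * omega R ^+ j * (if b then 1 else -1)%:~R = 1 + omega R ^+ (2 * j) ->
    s * e_ R 8 h * (if (`|h| %% 8 \in [:: 1; 7])%N then 1 else -1)%:~R
      = 1 + e_ R 8 (2 * h).
  move=> hj -> E; rewrite (E8 _ _ hj) (E8 (2 * h) (2 * j)%N%:Z) ?wn //.
  by move: hj; clear; lia.
case: cases => hj.
- apply: (key 1%N true) => //; first by rewrite !inE; move: hj; clear; lia.
  by rewrite expr1 sw mulr1.
- apply: (key 3%N false) => //; first by rewrite !inE; move: hj; clear; lia.
  by rewrite (exprD _ 2 4) w4 exprS mulrA sw mulrDl -exprD w4 rmorphN1; ring.
- apply: (key 5%N false) => //; first by rewrite !inE; move: hj; clear; lia.
  rewrite (exprD _ 2 8) (exprM _ 4 2) (exprD _ 1 4) w4 expr1 mulrA sw.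
  by rewrite rmorphN1; ring.
apply: (key 7%N true) => //; first by rewrite !inE; move: hj; clear; lia.
rewrite (exprD _ 2 12) (exprM _ 4 3) (exprD _ 3 4) w4 exprS !mulrA sw.
by rewrite rmorph1; ring: w4.
Qed.

End AdditiveCharacter.

(** * Periodic sums and sums over the odd residues *)

Lemma sum_period_shift (V : zmodType) (F : nat -> V) (P s : nat) :
  (forall g, F (g + P)%N = F g) ->
  \sum_(0 <= g < P) F (g + s)%N = \sum_(0 <= g < P) F g.
Proof.
move=> F_per; elim: s => [|s IHs].
  by under eq_bigr do rewrite addn0.
rewrite -IHs; case: P F_per {IHs} => [|P] F_per; first by rewrite !big_geq.
rewrite big_nat_recr //= [RHS]big_nat_recl //= addrC addnS -addSn addnC F_per.
by congr (_ + _); apply: eq_bigr => g _; rewrite addnS.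
Qed.

Lemma sum_period_mul (V : zmodType) (F : nat -> V) (P Q : nat) :
  (forall g, F (g + P)%N = F g) ->
  \sum_(0 <= g < Q * P) F g = (\sum_(0 <= g < P) F g) *+ Q.
Proof.
move=> F_per; elim: Q => [|Q IHQ]; first by rewrite mul0n big_geq.
rewrite (@big_cat_nat _ _ _ (Q * P)) ?leq_mul2r ?leqnSn ?orbT //= IHQ mulrSr.
congr (_ + _); rewrite -{1}[(Q * P)%N]add0n big_addn mulSn addnK.
exact: sum_period_shift.
Qed.

Lemma count_odd_iota (a : nat) : count odd (iota 1 a.*2) = a.
Proof.
elim: a => // a IHa; rewrite doubleS -addn2 iotaD count_cat IHa /=.
by rewrite add0n odd_double /= addn1.
Qed.

Lemma pow5_inj_mod (m g1 g2 : nat) :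
  (1 < m)%N -> (g1 < 2 ^ (m - 2))%N -> (g2 < 2 ^ (m - 2))%N ->
  (2 ^+ m %| 5 ^+ g1 - 5 ^+ g2)%Z -> g1 = g2.
Proof.
move=> m_gt1; wlog le12 : g1 g2 / (g1 <= g2)%N.
  move=> W lt1 lt2 d12; case/orP: (leq_total g1 g2) => le; first exact: W.
  by symmetry; apply: W => //; rewrite dvdz_subC.
move=> lt1 lt2; rewrite -(subnK le12) exprD -[X in X - _]mul1r -mulrBl mulrC.
rewrite dvdz_pow2_oddl; last exact: oddzX.
rewrite dvdz_subC pow5_dvdE2 // => d12.
have : (g2 - g1 < 2 ^ (m - 2))%N by apply: leq_ltn_trans lt2; exact: leq_subr.
case: (posnP (g2 - g1)) => [/eqP|g_gt0]; first by move: le12; clear; lia.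
by move/(dvdn_leq g_gt0): d12; rewrite leqNgt => /negP.
Qed.

(* The odd residues modulo [2^m] are [x0 5^g] and [- x0 5^g] for
   [0 <= g < 2^(m-2)], since 5 has order [2^(m-2)] and is 1 modulo 4. *)
Lemma perm_odd_residues (m : nat) (x0 : int) : (1 < m)%N -> oddz x0 ->
  perm_eq [seq x <- index_iota 1 (2 ^ m).+1 | odd x]
    ([seq `|(x0 * 5 ^+ g %% 2 ^+ m)%Z|%N | g <- index_iota 0 (2 ^ (m - 2))] ++
     [seq `|(- x0 * 5 ^+ g %% 2 ^+ m)%Z|%N | g <- index_iota 0 (2 ^ (m - 2))]).
Proof.
move=> m_gt1 x0_odd; set L := (2 ^ (m - 2))%N.
have m_gt0 := ltnW m_gt1.
have nE : (2 ^ m = 4 * L)%N by rewrite -[in LHS](subnK m_gt1) expnD mulnC.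
have r_ge0 (y : int) : `|(y %% 2 ^+ m)%Z|%N = (y %% 2 ^+ m)%Z :> int.
  by rewrite gez0_abs // modz_ge0 ?pow2_neq0.
have r_eq (y y' : int) : `|(y %% 2 ^+ m)%Z|%N = `|(y' %% 2 ^+ m)%Z|%N ->
    (2 ^+ m %| y - y')%Z.
  by move=> E; rewrite -eqz_mod_dvd -[X in X == _]r_ge0 -[X in _ == X]r_ge0 E.
have inj (c : int) : oddz c -> {in index_iota 0 L &,
    injective (fun g => `|(c * 5 ^+ g %% 2 ^+ m)%Z|%N)}.
  move=> c_odd a b; rewrite !mem_index_iota /= => la lb /r_eq.
  by rewrite -mulrBr dvdz_pow2_oddl //; exact: pow5_inj_mod.
have x0N_odd : oddz (- x0) by move: x0_odd; rewrite /oddz; lia.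
have r_in (c : int) (g : nat) : oddz c ->
    `|(c * 5 ^+ g %% 2 ^+ m)%Z|%N \in [seq x <- index_iota 1 (2 ^ m).+1 | odd x].
  move=> c_odd; set y := c * _.
  have y_odd : oddz y by rewrite /y oddzM c_odd oddzX.
  have r_odd : odd `|(y %% 2 ^+ m)%Z|%N.
    rewrite -oddz_natE r_ge0 /oddz; apply: contra y_odd => d2.
    by rewrite (divz_eq y (2 ^+ m)) rpredD // dvdz_mull // dvd2_exp.
  rewrite mem_filter r_odd mem_index_iota.
  have := ltz_pmod y (exprn_gt0 m (isT : 0 < 2 :> int)).
  case: (`|_|%N) r_odd (r_ge0 y) => // r _ rE lt_r.
  have lt2 : (r.+1 < 2 ^ m)%N by rewrite -ltz_nat PoszX2 rE.
  by rewrite /= ltnS ltnW.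
set s2 := (_ ++ _).
have s2_uniq : uniq s2.
  rewrite cat_uniq !map_inj_in_uniq ?iota_uniq //; try exact: inj.
  (* The two halves are disjoint: a common element would give [5^a + 5^b = 0] modulo [2^m], but this
     sum is 2 modulo 4. *)
  rewrite andbT; apply/hasPn=> _ /mapP[a _ ->]; apply/negP=> /mapP[b _ /r_eq].
  have d4 (g : nat) : (2 ^+ 2 %| 5 ^+ g - 1)%Z by rewrite (pow5_dvdE 0 g) dvd1n.
  rewrite -[_ - _]opprB mulNr opprK -mulrDr dvdzE abszN -dvdzE dvdz_pow2_oddl //.
  move/(dvdz_pow2_le m_gt1); move: (d4 a) (d4 b); rewrite (_ : 2 ^+ 2 = 4) //.
  by clear; lia.
have s2_sub : {subset s2 <= [seq x <- index_iota 1 (2 ^ m).+1 | odd x]}.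
  by move=> x; rewrite mem_cat => /orP[]/mapP[g _ ->]; exact: r_in.
(* Equality follows by counting: both lists have [2^(m-1)] entries. *)
have [|_ E] := uniq_min_size s2_uniq s2_sub.
  rewrite size_cat !size_map size_iota size_filter /index_iota subSS !subn0 nE.
  by rewrite (_ : (4 * L = (2 * L).*2)%N) ?count_odd_iota; lia.
by apply: uniq_perm => //; rewrite filter_uniq // iota_uniq.
Qed.

(** In the enumeration starting at [x], the residue 1 occurs, so [x 5^g] or [- x 5^g] is 1; the
    power of 5 is then inverted using [5^(2^(m-2)) = 1]. *)
Lemma odd_residue_repr (m : nat) (x : int) : (1 < m)%N -> oddz x ->
  exists (g : nat) (b : bool), (2 ^+ m %| x - (-1) ^+ b * 5 ^+ g)%Z.
Proof.
move=> m_gt1 x_odd; have := perm_mem (perm_odd_residues m_gt1 x_odd) 1%N.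
rewrite mem_filter mem_index_iota /= (_ : (1 < _)%N) ?ltnS ?expn_gt0 // => /esym.
have P_gt0 : 0 < 2 ^+ m :> int by exact: exprn_gt0.
have step (c : int) (g : nat) :
    1%N = `|(c * 5 ^+ g %% 2 ^+ m)%Z|%N -> (2 ^+ m %| c * 5 ^+ g - 1)%Z.
  move=> E; rewrite -eqz_mod_dvd; apply/eqP.
  have -> : (c * 5 ^+ g %% 2 ^+ m)%Z = 1.
    by rewrite -(gez0_abs (modz_ge0 _ (pow2_neq0 m))) -E.
  rewrite modz_small // ler01 /= -{1}(expr0 2).
  by rewrite -(subnK m_gt1) exprD; have := exprn_gt0 (m - 2) (isT : 0 < 2 :> int); lia.
have inv5 (g : nat) : exists h : nat, (2 ^+ m %| 5 ^+ (g + h) - 1)%Z.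
  exists (g * (2 ^ (m - 2) - 1))%N.
  by rewrite -mulnS -subSn ?expn_gt0 // subn1 /= pow5_dvdE2 // dvdn_mull.
have fin (b : bool) (g : nat) : (2 ^+ m %| (-1) ^+ b * x * 5 ^+ g - 1)%Z ->
    exists (g : nat) (b : bool), (2 ^+ m %| x - (-1) ^+ b * 5 ^+ g)%Z.
  move=> /dvdzP[q1 E1]; have [h /dvdzP[q2 E2]] := inv5 g.
  exists h, b; apply/dvdzP; exists ((-1) ^+ b * 5 ^+ h * q1 - x * q2).
  rewrite mulrBl -!mulrA -E2 -E1 exprD; clear.
  by case: b; rewrite ?expr0 ?expr1; ring.
rewrite mem_cat => /orP[]/mapP[g _ /step].
  by move=> E; apply: (fin false g); rewrite expr0 mul1r.
by move=> E; apply: (fin true g); rewrite expr1 mulN1r.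
Qed.

(** The base point is left free so that a sum can be recentred at a solution of the characteristic
    equation, or multiplied through by a unit. *)
Lemma sum_odd_residues (V : zmodType) (m : nat) (F : int -> V) (x0 : int) :
  (1 < m)%N -> oddz x0 ->
  (forall x y : int, (2 ^+ m %| x - y)%Z -> F x = F y) ->
  (forall x : int, (2 %| x)%Z -> F x = 0) ->
  \sum_(1 <= x < (2 ^ m).+1) F x%:Z =
  \sum_(0 <= g < 2 ^ (m - 2)) (F (x0 * 5 ^+ g) + F (- x0 * 5 ^+ g)).
Proof.
move=> m_gt1 x0_odd F_per F_even.
rewrite (bigID odd) /= [X in _ + X]big1_seq ?addr0; last first.
  by move=> x /andP[x_even _]; rewrite F_even // -[(_ %| _)%Z]negbK -/(oddz x) oddz_natE.
rewrite -big_filter (perm_big _ (perm_odd_residues m_gt1 x0_odd)) big_cat !big_map.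
have FE y : F `|(y %% 2 ^+ m)%Z|%N = F y.
  apply: F_per; rewrite gez0_abs ?modz_ge0 ?pow2_neq0 //.
  by rewrite -eqz_mod_dvd modz_mod.
by rewrite big_split /=; congr (_ + _); apply: eq_bigr => g _; rewrite FE.
Qed.

(** * Multiplicative characters modulo [2^m] *)

Section Character.
Variables (R : realType) (m : nat) (chi : int -> R[i]) (c : int).
Hypotheses (m_ge3 : (2 < m)%N) (chiP : is_char_mod2 m chi).
Hypothesis chi5 : chi 5 = e_ R (2 ^ (m - 2)) c.

Lemma chi_congr (x y : int) : (2 ^+ m %| x - y)%Z -> chi x = chi y.
Proof. by case: chiP => + _ _ _ => H xy; apply: H; rewrite eqz_mod_dvd. Qed.

Lemma chiM (x y : int) : chi (x * y) = chi x * chi y.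
Proof. by case: chiP. Qed.

Lemma chi_1 : chi 1 = 1.
Proof. by case: chiP. Qed.

Lemma chi_even (x : int) : (2 %| x)%Z -> chi x = 0.
Proof. by case: chiP => _ _ _; apply. Qed.

Lemma chiX (x : int) (w : nat) : chi (x ^+ w) = chi x ^+ w.
Proof. by elim: w => [|w IHw]; rewrite ?chi_1 // !exprS chiM IHw. Qed.

Lemma chi_pow5 (w : nat) : chi (5 ^+ w) = e_ R (2 ^ (m - 2)) (c * w%:Z).
Proof. by rewrite chiX chi5 e_M. Qed.

Lemma chiN1_sq : chi (-1) ^+ 2 = 1.
Proof. by rewrite -chiX sqrrN expr1n chi_1. Qed.

Lemma chiN1 : chi (-1) = 1 \/ chi (-1) = -1.
Proof. by move/eqP: chiN1_sq; rewrite sqrf_eq1 => /orP[]/eqP->; [left|right]. Qed.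

(* The binomial expansion of [(1 + R_s 2^s)^z] is linear modulo [2^m] because
   [m <= 2 s]. *)
Lemma chi_shift (s : nat) (Y y' r' b : int) :
  (1 < s)%N -> (s <= m)%N -> (m <= s.*2)%N ->
  (2 ^+ m %| Y * y' - 1)%Z -> (2 ^+ (m - s) %| Rseq s * r' - 1)%Z ->
  chi (Y + 2 ^+ s * b)
    = chi Y * e_ R (2 ^ (m - 2)) (c * (2 ^+ (s - 2) * (y' * b * r'))).
Proof.
move=> s_gt1 le_sm le_m2s /dvdzP[q1 E1] /dvdzP[q2 E2].
(* A nonnegative representative of [y' b r'], so that it can serve as an exponent of 5. *)
pose z := `|(y' * b * r' %% 2 ^+ m)%Z|%N; pose q3 := (y' * b * r' %/ 2 ^+ m)%Z.
have zE : z%:Z = y' * b * r' - q3 * 2 ^+ m.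
  by rewrite gez0_abs ?modz_ge0 ?pow2_neq0 // [in RHS](divz_eq _ (2 ^+ m)) addrC addKr.
have -> : e_ R (2 ^ (m - 2)) (c * (2 ^+ (s - 2) * (y' * b * r')))
    = chi (5 ^+ (2 ^ (s - 2) * z)).
  rewrite chi_pow5 PoszM PoszX2; apply: e_congr; first by rewrite expn_gt0.
  rewrite PoszX2 zE -!mulrBr opprB addrC subrK mulrCA; do 3!apply: dvdz_mull.
  by apply: dvdz_exp2l; exact: leq_subr.
rewrite -chiM; apply: chi_congr; rewrite dvdz_subC exprM RseqE //.
have [q ->] := expr1D_mod2 (Rseq s * 2 ^+ s) z.
have mE : 2 ^+ m = 2 ^+ s * 2 ^+ (m - s) :> int by rewrite -exprD subnKC.
have sE : 2 ^+ s * 2 ^+ s = 2 ^+ m * 2 ^+ (s.*2 - m) :> int.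
  by rewrite -!exprD subnKC // addnn.
apply/dvdzP; exists (Y * Rseq s ^+ 2 * 2 ^+ (s.*2 - m) * q - Y * q3 * Rseq s * 2 ^+ s
  + b * Rseq s * r' * q1 * 2 ^+ s + b * q2).
have -> : Y * (1 + z%:Z * (Rseq s * 2 ^+ s) + (Rseq s * 2 ^+ s) ^+ 2 * q)
    - (Y + 2 ^+ s * b)
  = Y * Rseq s ^+ 2 * (2 ^+ s * 2 ^+ s) * q + 2 ^+ s * (Y * Rseq s * z%:Z - b) by ring.
rewrite sE zE.
have -> : Y * Rseq s * (y' * b * r' - q3 * 2 ^+ m) - b
  = b * Rseq s * r' * (Y * y' - 1) + b * (Rseq s * r' - 1) - Y * Rseq s * q3 * 2 ^+ m by ring.
by rewrite E1 E2 mE; ring.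
Qed.

(** For even [c] the character is trivial at [5^(2^(m-3)) = 1 + R_(m-1) 2^(m-1)]. Multiplying an odd
    [y] by this number adds [2^(m-1)] modulo [2^m], so [chi] would have period [2^(m-1)]. *)
Lemma primitive_oddz : primitive_char2 m chi -> oddz c.
Proof.
move=> prim; rewrite /oddz; apply/negP=> c_even; apply: prim => x y.
rewrite eqz_mod_dvd => xy.
case: (boolP (2 %| y)%Z) => [y_even|y_odd].
  have x_even : (2 %| x)%Z.
    rewrite -[x](subrK y) rpredD //; apply: dvdz_trans xy; apply: dvd2_exp.
    by move: m_ge3; clear; lia.
  by rewrite !chi_even.
case/dvdzP: xy => q2 E2.
have mE : 2 ^+ m = 2 * 2 ^+ m.-1 :> int.
  by rewrite -exprS prednK //; move: m_ge3; clear; lia.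
have c5 : chi (5 ^+ (2 ^ (m - 3))) = 1.
  rewrite chi_pow5; apply: e_dvd; first by rewrite expn_gt0.
  have -> : (m - 2 = (m - 3).+1)%N by move: m_ge3; clear; lia.
  by rewrite !PoszX2 exprS dvdz_mul.
case: (boolP (2 %| q2)%Z) => [/dvdzP[q3 q2E]|q2_odd].
  by apply: chi_congr; rewrite E2 q2E -mulrA -mE dvdz_mull.
rewrite -[RHS]mul1r -c5 -chiM; apply: chi_congr.
have m3 : (1 < m.-1)%N by move: m_ge3; clear; lia.
have -> : (m - 3 = m.-1 - 2)%N by move: m_ge3; clear; lia.
rewrite RseqE //; have Ry_odd : oddz (Rseq m.-1 * y) by rewrite oddzM oddz_Rseq.
have /dvdzP[q3 E3] : (2 %| q2 - Rseq m.-1 * y)%Z.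
  by move: Ry_odd q2_odd; rewrite /oddz; clear; lia.
apply/dvdzP; exists q3; rewrite mE mulrA -E3 mulrBl -E2; ring.
Qed.

(** This is [chi_shift] at [s = m - 1], where the factor becomes [e_2] of a product of odd
    numbers. *)
Lemma chi_half (Y b : int) :
  oddz c -> oddz Y -> oddz b -> chi (Y + 2 ^+ m.-1 * b) = - chi Y.
Proof.
move=> c_odd Y_odd b_odd; have [y' Yy'] := oddz_inv m Y_odd.
have s_gt1 : (1 < m.-1)%N by move: m_ge3; clear; lia.
have [r' Rr'] := oddz_inv (m - m.-1) (oddz_Rseq s_gt1).
have s_le : (m.-1 <= m)%N by exact: leq_pred.
have s_ge : (m <= m.-1.*2)%N by move: m_ge3; clear; lia.
have inv_odd (j : nat) (u v : int) : (0 < j)%N -> (2 ^+ j %| u * v - 1)%Z -> oddz v.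
  move=> j_gt0 uv; have uv2 := dvdz_trans (dvd2_exp j_gt0) uv.
  have : oddz (u * v) by move: uv2; rewrite /oddz; clear; lia.
  by rewrite oddzM => /andP[].
rewrite (chi_shift b s_gt1 s_le s_ge Yy' Rr').
rewrite mulrCA (_ : m.-1 - 2 = m - 2 - 1)%N; last by clear; lia.
rewrite e_scale2; last by move: m_ge3; clear; lia.
rewrite e_2 ifN ?mulrN1 // -/(oddz _) !oddzM c_odd b_odd.
rewrite (inv_odd _ _ _ _ Yy') ?(inv_odd _ _ _ _ Rr') //; move: m_ge3; clear; lia.
Qed.

(** Only the sign in [x = ± 5^g] counts, and it is read off modulo 4 because [5^g] is 1 there. *)
Lemma chi_sign (x : int) : chi 5 = 1 -> oddz x ->
  exists2 b : bool, chi x = chi (-1) ^+ b & (4 %| x - (-1) ^+ b)%Z.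
Proof.
move=> chi5_1 x_odd; have [g [b xE]] := odd_residue_repr (ltnW m_ge3) x_odd.
exists b; first by rewrite (chi_congr xE) chiM !chiX chi5_1 expr1n mulr1.
rewrite -[x](subrK ((-1) ^+ b * 5 ^+ g)) -addrA rpredD //.
  by apply: (dvdz_pow2_le _ xE : (2 ^+ 2 %| _)%Z); exact: ltnW.
by rewrite -[X in _ - X]mulr1 -mulrBr dvdz_mull // (pow5_dvdE 0 g) dvd1n.
Qed.

End Character.

(** * The sum for [m = n + N + d]: reduction to the characteristic equation *)

Section BinomialSum.
Variables (R : realType) (m n t k k1 J d : nat) (chi1 chi2 : int -> R[i]).
Variables (A A1 B c1 c2 c3 Rinv : int).
Let N := (J + t + 2)%N.
Hypotheses (m_ge3 : (2 < m)%N) (n_gt0 : (0 < n)%N).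
Hypotheses (mE : (m = n + N + d)%N) (le_dN : (d <= N)%N).
Hypotheses (chi1P : is_char_mod2 m chi1) (chi2P : is_char_mod2 m chi2).
Hypothesis chi1_5 : chi1 5 = e_ R (2 ^ (m - 2)) c1.
Hypothesis chi2_5 : chi2 5 = e_ R (2 ^ (m - 2)) c2.
Hypotheses (c1E : c1 = 2 ^+ (n + t) * c3) (c2_odd : oddz c2).
Hypotheses (AE : A = 2 ^+ n * A1) (kE : k = (2 ^ t * k1)%N).
Hypotheses (A1_odd : oddz A1) (k1_odd : odd k1) (B_odd : oddz B).
Hypothesis RinvP : (2 ^+ m %| Rseq (N + n) * Rinv - 1)%Z.

Let Y (x : int) : int := A * x ^+ k + B.
Let f (x : int) : R[i] := chi1 x * chi2 (Y x).
(* [2^(n+t) cc x] is the paper's [C(x)]. *)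
Let cc (x : int) : int :=
  c3 * (A * x ^+ k + B) + c2 * A1 * k1%:Z * x ^+ k * Rseq N * Rinv.

Lemma Y_oddz (x : int) : oddz (Y x).
Proof.
have A_even : (2 %| A)%Z by rewrite AE dvdz_mulr // dvd2_exp.
have : (2 %| A * x ^+ k)%Z by rewrite dvdz_mulr.
by move: B_odd; rewrite /Y /oddz; clear; lia.
Qed.

Lemma Rinv_oddz : oddz Rinv.
Proof.
have : (2 %| Rseq (N + n) * Rinv - 1)%Z.
  by apply: dvdz_trans RinvP; apply: dvd2_exp; move: m_ge3; clear; lia.
move=> H; have : oddz (Rseq (N + n) * Rinv) by move: H; rewrite /oddz; clear; lia.
by rewrite oddzM => /andP[].
Qed.

Lemma f_congr (x y : int) : (2 ^+ m %| x - y)%Z -> f x = f y.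
Proof.
move=> xy; rewrite /f (chi_congr chi1P xy); congr (_ * _).
apply: (chi_congr chi2P); rewrite /Y opprD addrACA subrr addr0 -mulrBr.
by rewrite dvdz_mull // (dvdz_trans xy) // subrXX dvdz_mulr.
Qed.

Lemma f_even (x : int) : (2 %| x)%Z -> f x = 0.
Proof. by move=> x_even; rewrite /f (chi_even chi1P) ?mul0r. Qed.

Lemma pow5_kN (u : nat) :
  5 ^+ (k * (2 ^ J * u)) = (1 + Rseq N * 2 ^+ N) ^+ (k1 * u) :> int.
Proof.
rewrite -RseqE ?/N ?addn2 // -exprM; congr (_ ^+ _).
by rewrite kE !subSS subn0 expnD; ring.
Qed.

(** Here [5^(k 2^J u) = (1 + R_N 2^N)^(k1 u)]. The factor [2^n] of [A] and [d <= N] make its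
    quadratic terms vanish modulo [2^m], so [Y x] moves by a multiple of [2^(n+N)] and [chi_shift]
    applies with [s = n + N]. *)
Lemma f_step (x y' : int) (u : nat) : oddz x -> (2 ^+ m %| Y x * y' - 1)%Z ->
  f (x * 5 ^+ (2 ^ J * u)) = f x * e_ R (2 ^ d) (y' * cc x * u%:Z).
Proof.
move=> x_odd Yy'; have N_gt1 : (1 < N)%N by rewrite /N addn2.
have E2 : 2 ^+ (n + N - 2) = 2 ^+ (n + t) * 2 ^+ J :> int.
  by rewrite -exprD; congr (_ ^+ _); rewrite /N; clear; lia.
have -> : e_ R (2 ^ d) (y' * cc x * u%:Z)
    = e_ R (2 ^ (m - 2)) (2 ^+ (n + N - 2) * (y' * cc x * u%:Z)).
  rewrite -(@e_scale2 _ (m - 2)); last by rewrite mE; clear; lia.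
  by congr (e_ _ _ (2 ^+ _ * _)); rewrite mE; clear; lia.
have -> : f (x * 5 ^+ (2 ^ J * u)) = chi1 x * chi1 (5 ^+ (2 ^ J * u))
    * chi2 (Y x + 2 ^+ (n + N) * (A1 * x ^+ k * k1%:Z * u%:Z * Rseq N)).
  rewrite /f (chiM chi1P); congr (_ * _); apply: (chi_congr chi2P).
  rewrite /Y exprMn -exprM [(2 ^ J * u * k)%N]mulnC pow5_kN.
  have [q ->] := expr1D_mod2 (Rseq N * 2 ^+ N) (k1 * u).
  apply/dvdzP; exists (A1 * x ^+ k * Rseq N ^+ 2 * q * 2 ^+ (N - d)).
  have NE : 2 ^+ N = 2 ^+ (N - d) * 2 ^+ d :> int by rewrite -exprD subnK.
  have -> : A1 * x ^+ k * Rseq N ^+ 2 * q * 2 ^+ (N - d) * 2 ^+ m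
      = A1 * x ^+ k * Rseq N ^+ 2 * q * 2 ^+ n * 2 ^+ N * (2 ^+ (N - d) * 2 ^+ d).
    by rewrite mE !exprD; ring.
  by rewrite -NE AE exprD PoszM; ring.
have s_gt1 : (1 < n + N)%N by rewrite ltn_addl.
have s_le : (n + N <= m)%N by rewrite mE leq_addr.
have s_ge : (m <= (n + N).*2)%N by rewrite mE -addnn; move: le_dN; clear; lia.
have sR : (2 ^+ (m - (n + N)) %| Rseq (n + N) * Rinv - 1)%Z.
  rewrite [(n + N)%N]addnC; apply: dvdz_pow2_le RinvP; exact: leq_subr.
rewrite (chi_shift chi2P chi2_5 _ s_gt1 s_le s_ge Yy' sR).
rewrite (chi_pow5 chi1P chi1_5) mulrACA -e_D; congr (_ * _).
apply: e_congr; first by rewrite expn_gt0.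
rewrite PoszX2; apply: (@dvdz_trans (2 ^+ m)); first by rewrite dvdz_exp2l ?leq_subr.
rewrite dvdz_subC.
(* The contribution [c3] of [chi1] becomes [y' c3 (Y x)], which completes the exponent to
   [y' cc x]. *)
have -> : 2 ^+ (n + N - 2) * (y' * cc x * u%:Z)
     - (c1 * (2 ^ J * u)%N%:Z
        + c2 * (2 ^+ (n + N - 2) * (y' * (A1 * x ^+ k * k1%:Z * u%:Z * Rseq N) * Rinv)))
   = 2 ^+ (n + N - 2) * c3 * u%:Z * (Y x * y' - 1).
  by rewrite c1E PoszM PoszX2 E2 /cc /Y; ring.
by rewrite dvdz_mull.
Qed.

(** The difference is [5^(k w) - 1] times a cofactor that is odd, since [n > 0] makes its term in
    [c3] even. *)
Lemma cc_shift (i : nat) (x : int) (w : nat) : oddz x ->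
  (2 ^+ i %| cc (x * 5 ^+ w) - cc x)%Z = (2 ^+ i %| 5 ^+ (k * w) - 1)%Z.
Proof.
move=> x_odd.
have -> : cc (x * 5 ^+ w) - cc x =
  A1 * x ^+ k * (2 * (2 ^+ n.-1 * c3) + c2 * k1%:Z * Rseq N * Rinv) * (5 ^+ (k * w) - 1).
  rewrite /cc AE exprMn -exprM [(w * k)%N]mulnC -[in 2 ^+ n](prednK n_gt0) exprS; ring.
rewrite dvdz_pow2_oddl // !oddzM A1_odd oddzX //=.
have : oddz (c2 * k1%:Z * Rseq N * Rinv).
  by rewrite !oddzM c2_odd oddz_natE k1_odd oddz_Rseq ?Rinv_oddz // /N addn2.
by rewrite /oddz; clear; lia.
Qed.

(** The part of [f] that survives the averaging; it is invariant under multiplication by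
    [5^(2^J)]. *)
Let G (x : int) : R[i] := if (2 ^+ d %| cc x)%Z then f x else 0.

Lemma dvd_cc_shift (x : int) (u : nat) : oddz x ->
  (2 ^+ d %| cc (x * 5 ^+ (2 ^ J * u)))%Z = (2 ^+ d %| cc x)%Z.
Proof.
move=> x_odd; rewrite -[cc (_ * _)](subrK (cc x)) rpredDl //.
rewrite [_ \in _]cc_shift //; apply: (dvdz_pow2_le le_dN).
rewrite pow5_dvdE2 ?/N ?addn2 // !subSS subn0 kE.
have -> : (2 ^ t * k1 * (2 ^ J * u) = k1 * u * 2 ^ (J + t))%N by rewrite expnD; ring.
exact: dvdn_mull.
Qed.

Lemma G_period (x : int) : oddz x -> G (x * 5 ^+ (2 ^ J)) = G x.
Proof.
move=> x_odd; rewrite -[(2 ^ J)%N]muln1 /G dvd_cc_shift //.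
case: ifP => // cc_dvd; have [y' Yy'] := oddz_inv m (Y_oddz x).
rewrite (f_step _ x_odd Yy') e_dvd ?expn_gt0 ?mulr1 // PoszX2.
exact: dvdz_mull.
Qed.

Lemma sum_f_pow5 (x : int) : oddz x ->
  \sum_(0 <= g < 2 ^ (m - 2)) f (x * 5 ^+ g)
  = \sum_(0 <= g < 2 ^ (m - 2)) G (x * 5 ^+ g).
Proof.
move=> x_odd; have f_per g : f (x * 5 ^+ (g + 2 ^ (m - 2))) = f (x * 5 ^+ g).
  apply: f_congr; rewrite -mulrBr dvdz_mull // exprD -{2}[5 ^+ g]mulr1 -mulrBr.
  by rewrite dvdz_mull // pow5_dvdE2 ?dvdnn // ltnW.
have two_neq0 : 2 ^+ d != 0 :> R[i] by rewrite expf_neq0 // pnatr_eq0.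
(* Take [2^d] copies of the sum, shift the index of the [u]-th copy by [2^J u], and sum over [u]
   first: orthogonality keeps [f] where [2^d] divides [cc]. *)
apply: (mulfI two_neq0); rewrite -natrX mulr_natl -[in LHS](subn0 (2 ^ d)%N).
rewrite -sumr_const_nat.
under eq_bigr => u _ do
  rewrite -(@sum_period_shift _ (fun g => f (x * 5 ^+ g)) _ (2 ^ J * u) f_per).
rewrite exchange_big /= mulr_sumr; apply: eq_bigr => g _.
have xg_odd : oddz (x * 5 ^+ g) by rewrite oddzM x_odd oddzX.
have [y' Yy'] := oddz_inv m (Y_oddz (x * 5 ^+ g)).
under eq_bigr => u _ do rewrite exprD mulrA (f_step u xg_odd Yy').
have y'_odd : oddz y'.
  have : (2 %| Y (x * 5 ^+ g) * y' - 1)%Z.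
    by apply: dvdz_trans Yy'; apply: dvd2_exp; move: m_ge3; clear; lia.
  move=> H; have : oddz (Y (x * 5 ^+ g) * y') by move: H; rewrite /oddz; clear; lia.
  by rewrite oddzM => /andP[].
rewrite -mulr_sumr sum_e_pow2 dvdz_pow2_oddl // /G.
by case: ifP => _; [rewrite natrX mulrC | rewrite !mulr0].
Qed.

Lemma S_eq (x : int) : oddz x ->
  Ssum m k chi1 chi2 A B =
  2 ^+ (m - 2 - J) * \sum_(0 <= w < 2 ^ J) (G (x * 5 ^+ w) + G (- x * 5 ^+ w)).
Proof.
move=> x_odd; have m_gt1 := ltnW m_ge3.
have xN_odd : oddz (- x) by move: x_odd; rewrite /oddz; clear; lia.
rewrite /Ssum (sum_odd_residues m_gt1 x_odd f_congr f_even) big_split /=.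
rewrite !sum_f_pow5 // -big_split /=.
have -> : (2 ^ (m - 2) = 2 ^ (m - 2 - J) * 2 ^ J)%N.
  by rewrite -expnD subnK // mE /N; clear; lia.
rewrite (@sum_period_mul _ (fun g => G (x * 5 ^+ g) + G (- x * 5 ^+ g))).
  by rewrite -[LHS]mulr_natl natrX.
by move=> g; rewrite exprD !mulrA !G_period // oddzM ?x_odd ?xN_odd oddzX.
Qed.


(** Starting the enumeration of odd residues at [h] instead of 1 does not change the sum, and it
    multiplies every term by [chi1 h]. *)
Lemma S_mul_chi (h : int) : (forall y, f (h * y) = chi1 h * f y) ->
  (exists (g : nat) (b : bool), (2 ^+ m %| h - (-1) ^+ b * 5 ^+ g)%Z) ->
  Ssum m k chi1 chi2 A B = chi1 h * Ssum m k chi1 chi2 A B.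
Proof.
move=> fh [g [b hE]]; have m_gt1 := ltnW m_ge3.
have h_odd : oddz h.
  have h2 : (2 %| h - (-1) ^+ b * 5 ^+ g)%Z.
    by apply: dvdz_trans hE; apply: dvd2_exp; move: m_ge3; clear; lia.
  have : oddz ((-1) ^+ b * 5 ^+ g) by rewrite oddzM !oddzX.
  by move: h2; rewrite /oddz; clear; lia.
have o1 : oddz 1 by [].
rewrite /Ssum [in LHS](sum_odd_residues m_gt1 h_odd f_congr f_even).
rewrite [in RHS](sum_odd_residues m_gt1 o1 f_congr f_even) mulr_sumr.
by apply: eq_bigr => w _; rewrite mulrDr -!fh mul1r mulN1r mulrN mulNr.
Qed.

Lemma S_neq0_dvd_c1 : Ssum m k chi1 chi2 A B != 0 -> (2 ^+ (n + t) %| c1)%Z.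
Proof.
move=> S_neq0; pose h : int := 5 ^+ (2 ^ (J + d)).
(* Since [m - n - 2 = J + d + t], the power [h^k] is 1 modulo [2^(m-n)], and [A] supplies the
   missing [2^n]. *)
have kh : (2 ^+ (m - n) %| h ^+ k - 1)%Z.
  rewrite /h -exprM pow5_dvdE2; last by rewrite mE /N; clear; lia.
  rewrite kE; have -> : (m - n - 2 = J + d + t)%N by rewrite mE /N; clear; lia.
  by rewrite mulnA -expnD dvdn_mulr.
have fh y : f (h * y) = chi1 h * f y.
  rewrite /f (chiM chi1P) -mulrA; congr (_ * (_ * _)).
  apply: (chi_congr chi2P); case/dvdzP: kh => q hk.
  apply/dvdzP; exists (A1 * y ^+ k * q).
  have -> : Y (h * y) - Y y = A * y ^+ k * (h ^+ k - 1) by rewrite /Y exprMn; ring.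
  have -> : 2 ^+ m = 2 ^+ n * 2 ^+ (m - n) :> int.
    by rewrite -exprD subnKC // mE -addnA leq_addr.
  by rewrite hk AE; ring.
have /eqP : Ssum m k chi1 chi2 A B = chi1 h * Ssum m k chi1 chi2 A B.
  apply: S_mul_chi fh _; exists (2 ^ (J + d))%N, false.
  by rewrite expr0 mul1r subrr dvdz0.
rewrite -subr_eq0 -[X in X - _]mul1r -mulrBl mulf_eq0 (negPf S_neq0) orbF.
rewrite subr_eq0 eq_sym (chi_pow5 chi1P chi1_5) e_pow2_eq1 PoszX2.
have -> : (m - 2 = (J + d) + (n + t))%N by rewrite mE /N; clear; lia.
by rewrite mulrC dvdz_pow2_shift.
Qed.

Lemma S_neq0_chiN1 :
  Ssum m k chi1 chi2 A B != 0 -> ~~ odd k -> chi1 (-1) = 1.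
Proof.
move=> S_neq0 k_even.
have fN y : f (-1 * y) = chi1 (-1) * f y.
  rewrite /f (chiM chi1P) -mulrA; congr (_ * (_ * chi2 _)).
  by rewrite /Y mulN1r exprNn -signr_odd (negPf k_even) expr0 mul1r.
have /eqP : Ssum m k chi1 chi2 A B = chi1 (-1) * Ssum m k chi1 chi2 A B.
  by apply: S_mul_chi fN _; exists 0%N, true; rewrite expr0 expr1 mulr1 subrr dvdz0.
rewrite -subr_eq0 -[X in X - _]mul1r -mulrBl mulf_eq0 (negPf S_neq0) orbF.
by rewrite subr_eq0 => /eqP.
Qed.

Lemma S_neq0_sol : Ssum m k chi1 chi2 A B != 0 ->
  exists2 x, oddz x & (2 ^+ d %| cc x)%Z.
Proof.
rewrite (S_eq (isT : oddz 1)).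
pose P w := (2 ^+ d %| cc (1 * 5 ^+ w))%Z || (2 ^+ d %| cc (- 1 * 5 ^+ w))%Z.
case: (boolP (has P (index_iota 0 (2 ^ J)))) => [/hasP[w _ Pw] _|/hasPn noP].
  case/orP: Pw => Pw; [exists (1 * 5 ^+ w) | exists (- 1 * 5 ^+ w)] => //;
  by rewrite oddzM oddzX.
rewrite big1_seq ?mulr0 ?eqxx // => w /andP[_ /noP]; rewrite /P negb_or.
by case/andP=> /negPf nw1 /negPf nw2; rewrite /G nw1 nw2 addr0.
Qed.

(** The second summand of [cc x] and the factor [Y x] of [c3] are both odd. *)
Lemma cc_oddE (x : int) : oddz x -> (2 %| cc x)%Z = oddz c3.
Proof.
move=> x_odd; have : oddz (c2 * A1 * k1%:Z * x ^+ k * Rseq N * Rinv).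
  rewrite !oddzM c2_odd A1_odd oddz_natE k1_odd oddzX // oddz_Rseq ?Rinv_oddz //.
  by rewrite /N addn2.
have := oddzM c3 (Y x); rewrite Y_oddz andbT /cc -/(Y x) /oddz; clear.
by move=> <-; clear; lia.
Qed.

Lemma sol_c3_oddz (x : int) :
  (0 < d)%N -> oddz x -> (2 ^+ d %| cc x)%Z -> oddz c3.
Proof.
move=> d_gt0 x_odd dvd_cc; rewrite -(cc_oddE x_odd).
by apply: dvdz_trans dvd_cc; exact: dvd2_exp.
Qed.

Lemma cc_oppE (x : int) : odd k -> cc (- x) = 2 * c3 * B - cc x.
Proof.
by move=> k_odd; rewrite /cc exprNn -signr_odd k_odd expr1; ring.
Qed.

Lemma G_opp_even (x : int) : ~~ odd k -> chi1 (-1) = 1 -> G (- x) = G x.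
Proof.
move=> k_even chiN; have xk : (- x) ^+ k = x ^+ k.
  by rewrite exprNn -signr_odd (negPf k_even) expr0 mul1r.
by rewrite /G /f /cc /Y xk -mulN1r (chiM chi1P) chiN mul1r.
Qed.

Lemma k_oddE : odd k = (t == 0%N).
Proof. by rewrite kE oddM k1_odd andbT oddX orbF. Qed.

(** * The case [J = 0]: only the residues 1 and -1 remain *)

Lemma S_small_even : J = 0%N -> ~~ odd k -> chi1 (-1) = 1 ->
  Ssum m k chi1 chi2 A B
    = if (2 ^+ d %| cc 1)%Z then 2 ^+ (m - 1) * chi2 (A + B) else 0.
Proof.
move=> J0 k_even chiN; rewrite (S_eq (isT : oddz 1)) J0 expn0 big_nat1 expr0.
rewrite !mulr1 G_opp_even // subn0 /G /f /Y expr1n mulr1 (chi_1 chi1P) mul1r.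
case: ifP => _; last by rewrite addr0 mulr0.
have -> : (m - 1 = (m - 2).+1)%N by move: m_ge3; clear; lia.
by rewrite exprSr; ring.
Qed.

Lemma S_small_odd : J = 0%N -> odd k ->
  Ssum m k chi1 chi2 A B = 2 ^+ (m - 2) *
    ((if (2 ^+ d %| cc 1)%Z then chi2 (A + B) else 0)
     + (if (2 ^+ d %| cc (-1))%Z then chi1 (-1) * chi2 (- A + B) else 0)).
Proof.
move=> J0 k_odd; rewrite (S_eq (isT : oddz 1)) J0 expn0 big_nat1 expr0.
rewrite !mulr1 subn0 /G /f /Y expr1n mulr1 (chi_1 chi1P) mul1r.
by rewrite -signr_odd k_odd expr1 mulrN1.
Qed.

(** * The case [J > 0]: summation over the solutions of the characteristic equation *)

Section CharacteristicSolution.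
Variables (x0 : int).
Hypotheses (J_gt0 : (0 < J)%N) (le_Nd : (N <= d.+1)%N).
Hypotheses (x0_odd : oddz x0) (x0_sol : (2 ^+ d %| cc x0)%Z).
Hypothesis chi1N1 : ~~ odd k -> chi1 (-1) = 1.

Lemma d_ge : (t + 2 <= d)%N.
Proof. by move: le_Nd J_gt0; rewrite /N; clear; lia. Qed.

(** By [cc_shift] the condition is [2^d | 5^(k w) - 1], that is [2^(d-2) | k w], and [k] contributes
    exactly [2^t]. *)
Lemma sol_shiftE (w : nat) :
  (2 ^+ d %| cc (x0 * 5 ^+ w))%Z = (2 ^ (d - 2 - t) %| w)%N.
Proof.
have d_ge2 := d_ge.
rewrite -[cc (_ * _)](subrK (cc x0)) rpredDr // [_ \in _]cc_shift //.
rewrite pow5_dvdE2; last by move: d_ge2; clear; lia.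
have -> : (d - 2 = t + (d - 2 - t))%N by move: d_ge2; clear; lia.
rewrite kE expnD -mulnA dvdn_pmul2l ?expn_gt0 // addKn Gauss_dvdr //.
by rewrite coprimeXl // coprime2n.
Qed.

(** For odd [k] the values of [cc] at opposite points add up to [2 c3 B], which is 2 modulo 4. As
    [cc (x0 5^w)] is divisible by 4, the opposite point is not a solution. *)
Lemma G_opp_odd (w : nat) : odd k -> G (- x0 * 5 ^+ w) = 0.
Proof.
move=> k_odd; have d_ge2 := d_ge; rewrite /G ifF //; apply/negbTE/negP.
have d2 : (2 <= d)%N by move: d_ge2; clear; lia.
move/(dvdz_pow2_le d2); rewrite mulNr cc_oppE //.
have : (2 ^+ 2 %| cc (x0 * 5 ^+ w))%Z.
  rewrite -[cc (_ * _)](subrK (cc x0)) rpredD //; last exact: dvdz_pow2_le x0_sol.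
  by rewrite [_ \in _]cc_shift // (pow5_dvdE 0) dvd1n.
have d_gt0 : (0 < d)%N by exact: ltnW.
have : oddz (c3 * B) by rewrite oddzM B_odd (sol_c3_oddz d_gt0 x0_odd x0_sol).
by rewrite -[2 * c3 * B]mulrA /oddz; move: (c3 * B) (cc _); clear; lia.
Qed.

(** The factor [2^(minn 1 t)] counts the opposite solutions: for even [k] they double the sum, for
    odd [k] there are none. *)
Lemma S_big : Ssum m k chi1 chi2 A B = 2 ^+ (m - 2 - J) * 2 ^+ (minn 1 t) *
  \sum_(0 <= w < 2 ^ J) (if (2 ^ (d - 2 - t) %| w)%N then f (x0 * 5 ^+ w) else 0).
Proof.
rewrite (S_eq x0_odd) -mulrA; congr (_ * _).
have GE w : G (x0 * 5 ^+ w) = if (2 ^ (d - 2 - t) %| w)%N then f (x0 * 5 ^+ w) else 0.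
  by rewrite /G sol_shiftE.
have [k_odd|k_even] := boolP (odd k).
  have -> : minn 1 t = 0%N by move: k_odd; rewrite k_oddE; clear; lia.
  rewrite expr0 mul1r; apply: eq_bigr => w _.
  by rewrite G_opp_odd // addr0 GE.
have -> : minn 1 t = 1%N by move: k_even; rewrite k_oddE; clear; lia.
rewrite expr1 mulr_sumr; apply: eq_bigr => w _.
by rewrite mulNr G_opp_even ?chi1N1 // GE mulr_natl mulr2n.
Qed.

Lemma S_big_even : d = N ->
  Ssum m k chi1 chi2 A B = 2 ^+ (n + N + t + minn 1 t) * f x0.
Proof.
move=> dN; rewrite S_big.
have -> : (d - 2 - t = J)%N by rewrite dN /N; clear; lia.
have -> : (m - 2 - J = n + N + t)%N by rewrite mE dN /N; clear; lia.
rewrite -exprD; congr (_ * _); rewrite big_ltn ?expn_gt0 // dvdn0 expr0 mulr1.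
rewrite big1_seq ?addr0 // => w; rewrite mem_index_iota => /andP[_ /andP[w_gt0 lt_w]].
by rewrite gtnNdvd.
Qed.

(** Now [d - 2 - t = J - 1], whose power of 2 has exactly two multiples below [2^J]. *)
Lemma S_big_odd : N = d.+1 ->
  Ssum m k chi1 chi2 A B
    = 2 ^+ (n + d + t + minn 1 t) * (f x0 + f (x0 * 5 ^+ (2 ^ J.-1))).
Proof.
move=> Nd; rewrite S_big.
have -> : (d - 2 - t = J.-1)%N by move: J_gt0 Nd; rewrite /N; clear; lia.
have -> : (m - 2 - J = n + d + t)%N.
  by move: J_gt0; rewrite mE Nd; move: Nd; rewrite /N; clear; lia.
rewrite -exprD; congr (_ * _); rewrite -[in X in index_iota _ X](prednK J_gt0).
set j := (2 ^ J.-1)%N; have j_gt0 : (0 < j)%N by rewrite expn_gt0.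
rewrite expnS mul2n -addnn -/j (@big_cat_nat _ _ _ j) ?leq_addr //=; congr (_ + _).
  rewrite big_ltn // dvdn0 expr0 mulr1.
  rewrite big1_seq ?addr0 // => w; rewrite mem_index_iota => /andP[_ /andP[w_gt0 lt_w]].
  by rewrite gtnNdvd.
rewrite big_ltn ?dvdnn; last by move: j_gt0; clear; lia.
rewrite big1_seq ?addr0 // => w; rewrite mem_index_iota => /andP[_ /andP[gt_w lt_w]].
by rewrite -{1}(subnK (ltnW gt_w)) dvdn_addl // gtnNdvd // ?subn_gt0 // ltn_subLR // ltnW.
Qed.


(* After multiplication by [Y x0] and division by [2^(d-1)] this is a congruence
   modulo 4, in which the characteristic equation enters as
   [c3 Y + v k1 R_N = 0 mod 4], where [v = c2 A1 x0^k Rinv]. *)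
Lemma half_step_exponent (lam y' : int) : N = d.+1 ->
  cc x0 = lam * 2 ^+ d -> (2 ^+ m %| Y x0 * y' - 1)%Z ->
  (2 ^+ d.+1 %|
    c3 + c2 * (y' * (A1 * x0 ^+ k * (k1%:Z * Rseq N - 2 ^+ d.-1))
               * (Rinv * (1 + 2 ^+ (n + d).-1)))
    - 2 ^+ d.-1 * (2 * lam + (k1%:Z - 1) + (2 ^+ n - 1) * c3))%Z.
Proof.
move=> Nd ccE Yy'; have d_ge2 := d_ge.
have d_gt1 : (1 < d)%N by move: d_ge2; clear; lia.
have N_gt2 : (2 < N)%N by rewrite Nd.
rewrite -(dvdz_pow2_oddl d.+1 _ (Y_oddz x0)).
have /dvdzP[q1 E1] : (2 ^+ d.+1 %| Y x0 * y' - 1)%Z.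
  by apply: dvdz_pow2_le Yy'; rewrite mE Nd; clear; lia.
pose v := c2 * A1 * x0 ^+ k * Rinv; pose h := 2 * lam + (k1%:Z - 1) + (2 ^+ n - 1) * c3.
have v_odd : oddz v by rewrite !oddzM c2_odd A1_odd oddzX ?Rinv_oddz.
have ccE' : c3 * Y x0 + v * k1%:Z * Rseq N = lam * 2 ^+ d.
  by rewrite -ccE /cc /v /Y; ring.
have d1E : 2 ^+ d = 2 * 2 ^+ d.-1 :> int by rewrite -exprS prednK // ltnW.
have ndE : 2 ^+ (n + d).-1 = 2 ^+ n * 2 ^+ d.-1 :> int.
  by rewrite -exprD; congr (_ ^+ _); move: d_gt1; clear; lia.
rewrite -/h; set b := k1%:Z * Rseq N - 2 ^+ d.-1.
have -> : Y x0 * (c3 + c2 * (y' * (A1 * x0 ^+ k * b) * (Rinv * (1 + 2 ^+ (n + d).-1)))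
                  - 2 ^+ d.-1 * h)
   = 2 ^+ d.-1 * (2 * lam - v + 2 ^+ n * v * b - Y x0 * h)
     + (Y x0 * y' - 1) * v * b * (1 + 2 ^+ (n + d).-1).
  transitivity (c3 * Y x0 + v * k1%:Z * Rseq N - v * 2 ^+ d.-1
     + v * b * 2 ^+ (n + d).-1
     + (Y x0 * y' - 1) * v * b * (1 + 2 ^+ (n + d).-1) - Y x0 * 2 ^+ d.-1 * h).
    by rewrite /b /v; ring.
  by rewrite ccE' d1E ndE; ring.
rewrite rpredD //; last by rewrite -!mulrA dvdz_mulr // E1 dvdz_mull.
have -> : d.+1 = (d.-1 + 2)%N by move: d_gt1; clear; lia.
rewrite dvdz_pow2_shift.
have [l lE] : exists l, k1%:Z = 2 * l + 1 by apply/oddzP; rewrite oddz_natE.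
have [a YE] := oddzP _ (Y_oddz x0); have [e vE] := oddzP _ v_odd.
have /dvdzP[r rE] := Rseq_mod4 N_gt2.
have nE : 2 ^+ n = 2 * 2 ^+ n.-1 :> int by rewrite -exprS prednK.
have dE : 2 ^+ d.-1 = 2 * 2 ^+ d.-2 :> int.
  by rewrite -exprS; congr (_ ^+ _); move: d_gt1; clear; lia.
have RE : Rseq N = r * 4 - 1 by rewrite -rE addrK.
have c3Y : Y x0 * c3 = 4 * (lam * 2 ^+ d.-2) - v * k1%:Z * Rseq N.
  by rewrite mulrC -[LHS](addrK (v * k1%:Z * Rseq N)) ccE' d1E dE; ring.
(* With [R_N = -1] modulo 4 everything collapses to [(k1 - 1) (v - Y x0)], a product of two even
   numbers; it gives the term [l * (e - a)] of the witness. *)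
apply/dvdzP; exists (2 ^+ n.-1 * v * k1%:Z * Rseq N - 2 ^+ n.-1 * v * 2 ^+ d.-2
   - lam * a - r * v * k1%:Z + l * (e - a) - lam * 2 ^+ d.-2 * (2 ^+ n - 1)).
have -> : Y x0 * h = 2 * lam * Y x0 + Y x0 * (k1%:Z - 1) + (2 ^+ n - 1) * (Y x0 * c3).
  by rewrite /h; ring.
rewrite c3Y /b nE dE RE YE; rewrite lE vE; ring.
Qed.

Lemma f_half_step (lam : int) : N = d.+1 -> cc x0 = lam * 2 ^+ d ->
  f (x0 * 5 ^+ (2 ^ J.-1))
    = f x0 * e_ R 4 (2 * lam + (k1%:Z - 1) + (2 ^+ n - 1) * c3).
Proof.
move=> Nd ccE; have d_ge2 := d_ge.
have d_gt1 : (1 < d)%N by move: d_ge2; clear; lia.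
have d_gt0 := ltnW d_gt1.
have [y' Yy'] := oddz_inv m (Y_oddz x0).
set h := _ + _ * c3; pose s := (n + d)%N.
(* The quadratic term no longer vanishes, as [2^(n+2d) = 2^(m-1)]. The summand [- 2^(d-1)] accounts
   both for it and for the passage from [R_d] to [R_N]. *)
pose b := A1 * x0 ^+ k * (k1%:Z * Rseq N - 2 ^+ d.-1).
(* An inverse of [R_s] modulo [2^(d+1)], corrected from that of [R_(s+1) = R_(N+n)]; as
   [s - 1 >= d], only the parity of the cofactor of [2^(s-1)] matters. *)
pose r' := Rinv * (1 + 2 ^+ s.-1).
have s_gt1 : (1 < s)%N by rewrite ltn_addl.
have mE' : m = (s + d.+1)%N by rewrite mE Nd /s; clear; lia.
have s_le : (s <= m)%N by rewrite mE' leq_addr.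
have s_ge : (m <= s.*2)%N by rewrite mE' /s; move: n_gt0; clear; lia.
have RN : Rseq N = Rseq d + 2 ^+ d.-1 * Rseq d ^+ 2 by rewrite Nd RseqS.
have sR : (2 ^+ (m - s) %| Rseq s * r' - 1)%Z.
  have RS : Rseq s = Rseq (N + n) - 2 ^+ s.-1 * Rseq s ^+ 2.
    by rewrite Nd addSn addnC -/s RseqS // addrK.
  have E2 : 2 ^+ s.-1 = 2 ^+ d * 2 ^+ n.-1 :> int.
    by rewrite -exprD; congr (_ ^+ _); rewrite /s; move: n_gt0; clear; lia.
  have /dvdzP[q1 E1] : (2 ^+ d.+1 %| Rseq (N + n) * Rinv - 1)%Z.
    by apply: dvdz_pow2_le RinvP; rewrite mE'; clear; lia.
  have /dvdzP[q3 E3] : (2 %| 1 - Rseq s ^+ 2 * Rinv)%Z.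
    have : oddz (Rseq s ^+ 2 * Rinv) by rewrite oddzM Rinv_oddz oddzX ?oddz_Rseq.
    by rewrite /oddz; clear; lia.
  have E4 : 2 ^+ d * 2 ^+ d = 2 ^+ d.+1 * 2 ^+ d.-1 :> int.
    by rewrite -!exprD; congr (_ ^+ _); move: d_gt1; clear; lia.
  have -> : (m - s = d.+1)%N by rewrite mE' addKn.
  have -> : Rseq s * r' - 1 = (Rseq (N + n) * Rinv - 1) * (1 + 2 ^+ s.-1)
     + 2 ^+ s.-1 * (1 - Rseq s ^+ 2 * Rinv) - 2 ^+ s.-1 * 2 ^+ s.-1 * Rseq s ^+ 2 * Rinv.
    by rewrite {1}RS /r'; ring.
  rewrite E1 E3 E2; apply/dvdzP.
  exists (q1 * (1 + 2 ^+ d * 2 ^+ n.-1) + 2 ^+ n.-1 * q3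
          - 2 ^+ d.-1 * 2 ^+ n.-1 ^+ 2 * Rseq s ^+ 2 * Rinv).
  transitivity (q1 * 2 ^+ d.+1 * (1 + 2 ^+ d * 2 ^+ n.-1) + 2 ^+ d * 2 * 2 ^+ n.-1 * q3
      - (2 ^+ d * 2 ^+ d) * 2 ^+ n.-1 ^+ 2 * Rseq s ^+ 2 * Rinv); first by ring.
  by rewrite E4 -exprSr; ring.
have kw : 5 ^+ (k * 2 ^ J.-1) = (1 + Rseq d * 2 ^+ d) ^+ k1 :> int.
  rewrite -RseqE // -exprM; congr (_ ^+ _); rewrite kE.
  have -> : (d - 2 = t + J.-1)%N by move: Nd J_gt0; rewrite /N; clear; lia.
  by rewrite expnD; ring.
have YE : (2 ^+ m %| Y (x0 * 5 ^+ (2 ^ J.-1)) - (Y x0 + 2 ^+ s * b))%Z.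
  rewrite /Y exprMn -exprM [(2 ^ J.-1 * k)%N]mulnC kw.
  have [q ->] := expr1D_mod3 (Rseq d * 2 ^+ d) k1.
  have [l lE] : exists l, k1%:Z = 2 * l + 1 by apply/oddzP; rewrite oddz_natE.
  have CE : 'C(k1, 2)%:Z = l * (2 * l + 1).
    have k1_gt0 : (0 < k1)%N by case: k1 k1_odd.
    have := mul_bin_left k1 1; rewrite bin1 => /(congr1 Posz).
    rewrite !PoszM -subzn // lE => CE; apply: (mulfI (isT : (2 : int) != 0)).
    by rewrite [LHS]CE; ring.
  have /oddzP[a RdE] := oddz_Rseq d_gt1.
  have dE : 2 ^+ d = 2 * 2 ^+ d.-1 :> int by rewrite -exprS prednK.
  have mE2 : 2 ^+ m = 2 ^+ n * (2 ^+ d * (2 * 2 ^+ d)) :> int.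
    by rewrite mE' /s !exprD exprS; ring.
  apply/dvdzP.
  exists (A1 * x0 ^+ k * (l ^+ 2 * Rseq d ^+ 2 - a ^+ 2 - a
          + 2 ^+ d.-1 * Rseq d ^+ 3 * q)).
  rewrite CE /b RN AE mE2 /s exprD dE lE RdE; move: (2 ^+ n) (2 ^+ d.-1) (x0 ^+ k).
  by clear; move=> u v w; ring.
rewrite {1}/f (chi_congr chi2P YE) (chi_shift chi2P chi2_5 _ s_gt1 s_le s_ge Yy' sR).
rewrite (chiM chi1P) (chi_pow5 chi1P chi1_5) mulrACA -e_D; congr (_ * _).
have -> : e_ R 4 h = e_ R (2 ^ (m - 2)) (2 ^+ (s - 2) * (2 ^+ d.-1 * h)).
  rewrite mulrA -exprD -(@e_scale2 _ (m - 2) 2); last by rewrite mE'; move: d_gt1; clear; lia.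
  by congr (e_ _ _ (2 ^+ _ * _)); rewrite mE'; move: d_gt1 s_gt1; clear; lia.
apply: e_congr; first by rewrite expn_gt0.
have c1E' : c1 * (2 ^ J.-1)%N%:Z = 2 ^+ (s - 2) * c3.
  rewrite PoszX2 c1E mulrAC -exprD; congr (2 ^+ _ * _).
  by move: Nd J_gt0; rewrite /s /N; clear; lia.
rewrite c1E' PoszX2 [c2 * _]mulrCA -mulrDr -mulrBr.
have -> : (m - 2 = (s - 2) + d.+1)%N by rewrite mE'; move: s_gt1; clear; lia.
by rewrite dvdz_pow2_shift; exact: half_step_exponent.
Qed.

End CharacteristicSolution.

End BinomialSum.

(** * Choice of [J] and [d], and the four cases *)

Lemma Nval_spec (m n t : nat) : (t + 2 <= m - n)%N ->
  exists J d, [/\ Nval m n t = (J + t + 2)%N, m = (n + (J + t + 2) + d)%N,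
    (d <= J + t + 2)%N &
    if (2 * t + 4 < m - n)%N then
      (0 < J)%N /\ (J + t + 2 = d + odd (m - n))%N
    else J = 0%N].
Proof.
move=> le_t; rewrite /Nval uphalf_half.
have := odd_double_half (m - n); move: (odd (m - n)) (_./2) => b h mn.
case: ifP => big.
  (* Here [m - n = b + 2 h], so [N = b + h] and [d = h]. *)
  by exists (b + h - t - 2)%N, h; move: le_t mn big; clear; case: b => /=; split; try split; lia.
exists 0%N, (m - n - t - 2)%N; move: le_t mn big; clear; case: b => /=; split; lia.
Qed.

Lemma sqrt2X (R : realType) (p : nat) :
  ((Num.sqrt (2 : R)) ^+ p.*2)%:C%C = 2 ^+ p :> R[i].
Proof.
by rewrite -muln2 mulnC exprM sqr_sqrtr ?ler0n // rmorphXn /= rmorph_nat.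
Qed.

Theorem theorem1p1 (R : realType) (m : nat) (chi1 chi2 : int -> R[i])
  (A B : int) (k : nat) (n t : nat) (A1 : int) (k1 : nat)
  (c1 c2 Rinv : int) :
  (3 <= m)%N ->
  is_char_mod2 m chi1 -> is_char_mod2 m chi2 -> primitive_char2 m chi2 ->
  (1 <= k)%N ->
  A = 2 ^+ n * A1 -> (0 < n)%N -> k = (2 ^ t * k1)%N ->
  ~~ (2 %| A1 * k1%:Z * B)%Z ->
  1 <= c1 <= 2 ^+ (m - 2) -> chi1 5 = e_ R (2 ^ (m - 2)) c1 ->
  1 <= c2 <= 2 ^+ (m - 2) -> chi2 5 = e_ R (2 ^ (m - 2)) c2 ->
  (Rseq (Nval m n t + n) * Rinv == 1 %[mod 2 ^+ m])%Z ->
  (t + 2 <= m - n)%N ->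
  let S := Ssum m k chi1 chi2 A B in
  let C := Cfun m n t k A B c1 c2 Rinv in
  let M := ((m + n)./2 + t)%N in
  (* S = 0 unless the conditions hold *)
  (S != 0 ->
     [/\ exists c3 : int, ~~ (2 %| c3)%Z /\ c1 = 2 ^+ (n + t) * c3,
         (~~ odd k -> chi1 (-1) = 1) &
         ((2 * t + 4 < m - n)%N ->
            exists x0 : int, ~~ (2 %| x0 * (A * x0 ^+ k + B))%Z /\
                             (2 ^+ M %| C x0)%Z)]) /\
  (forall c3 : int, ~~ (2 %| c3)%Z -> c1 = 2 ^+ (n + t) * c3 ->
   (~~ odd k -> chi1 (-1) = 1) ->
   ((2 * t + 4 < m - n)%N ->
      exists x0 : int, ~~ (2 %| x0 * (A * x0 ^+ k + B))%Z /\
                       (2 ^+ M %| C x0)%Z) ->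
   [/\
   (* (i) *)
   ((2 * t + 4 < m - n)%N ->
    forall x0 lam : int, ~~ (2 %| x0 * (A * x0 ^+ k + B))%Z ->
      C x0 = lam * 2 ^+ M ->
      let h := 2 * lam + (k1%:Z - 1) + (2 ^+ n - 1) * c3 in
      S = ((Num.sqrt (2 : R)) ^+ (m + n))%:C%C * 2 ^+ (t + minn 1 t)
          * chi1 x0 * chi2 (A * x0 ^+ k + B)
          * (if odd (m - n) then omega R ^ h * (jacobi 2 h)%:~R else 1)),
   (* (ii) *)
   ((t + 3 < m - n)%N -> (m - n <= 2 * t + 4)%N ->
    [/\ (~~ odd k -> (2 ^+ (m - 2) %| C 1)%Z ->
           S = 2 ^+ (m - 1) * chi2 (A + B)),
        (odd k -> (2 ^+ (m - 2) %| C 1)%Z ->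
           S = 2 ^+ (m - 2) * chi2 (A + B)),
        (odd k -> (2 ^+ (m - 2) %| C (-1))%Z ->
           S = 2 ^+ (m - 2) * chi1 (-1) * chi2 (- A + B)) &
        (~ [\/ ~~ odd k /\ (2 ^+ (m - 2) %| C 1)%Z,
               odd k /\ (2 ^+ (m - 2) %| C 1)%Z |
               odd k /\ (2 ^+ (m - 2) %| C (-1))%Z] ->
           S = 0)]),
   (* (iii) *)
   ((m - n = t + 3)%N ->
    [/\ (~~ odd k -> (chi1 5 = 1 \/ chi1 5 = -1) -> chi1 (-1) = 1 ->
           S = 2 ^+ (m - 1) * chi2 (A + B)),
        (odd k -> (chi1 5 = 1 \/ chi1 5 = -1) ->
           S = 2 ^+ (m - 2) * (chi2 (A + B) + chi1 (-1) * chi2 (- A + B))) &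
        (~ [\/ ~~ odd k /\ (chi1 5 = 1 \/ chi1 5 = -1) /\ chi1 (-1) = 1 |
               odd k /\ (chi1 5 = 1 \/ chi1 5 = -1)] ->
           S = 0)]) &
   (* (iv) *)
   ((m - n = t + 2)%N ->
    ((~~ odd k /\ chi1 =1 chi0 R) \/ (odd k /\ chi1 =1 chi4 R) ->
       S = 2 ^+ (m - 1) * chi2 (A + B)) /\
    (~ ((~~ odd k /\ chi1 =1 chi0 R) \/ (odd k /\ chi1 =1 chi4 R)) ->
       S = 0))]).
Proof.
move=> m_ge3 chi1P chi2P chi2_prim _ AE n_gt0 kE odd_A1k1B c1_bound chi1_5 _ chi2_5.
rewrite eqz_mod_dvd => RinvP le_t S C M.
have c2_odd : oddz c2 by exact: primitive_oddz chi2_prim.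
have [A1_odd k1_odd B_odd] : [/\ oddz A1, odd k1 & oddz B].
  by move: odd_A1k1B; rewrite -/(oddz _) !oddzM oddz_natE => /andP[/andP[]].
have [J [d [NE mE le_dN bigE]]] := Nval_spec le_t.
rewrite NE in RinvP; have kodd := k_oddE kE k1_odd.
pose cc c3 x : int :=
  c3 * (A * x ^+ k + B) + c2 * A1 * k1%:Z * x ^+ k * Rseq (J + t + 2) * Rinv.
have CE c3 x : c1 = 2 ^+ (n + t) * c3 -> C x = 2 ^+ (n + t) * cc c3 x.
  move=> c1E; rewrite /C /Cfun /cc NE; move: (x ^+ k) => u.
  by rewrite c1E AE kE PoszM PoszX2 !exprD; ring.
(* With this value of [M], the characteristic equation reads [2^d | cc x]. *)
have ME : (2 * t + 4 < m - n)%N -> M = (n + t + d)%N.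
  move=> big; rewrite big in bigE; case: bigE => _ Jd; rewrite /M.
  have -> : (m + n = odd (m - n) + (n + d).*2)%N.
    by move: mE Jd; move: (odd (m - n)) => b; clear; lia.
  by rewrite half_bit_double; clear; lia.
have YP (x : int) : oddz (A * x ^+ k + B) by exact: (@Y_oddz n k A A1 B).
have x0P (x : int) : ~~ (2 %| x * (A * x ^+ k + B))%Z = oddz x.
  by rewrite -/(oddz _) oddzM YP andbT.
split=> [S_neq0|c3 c3_odd c1E chi1N char_sol].
  have /dvdzP[c3 c1E] := S_neq0_dvd_c1 m_ge3 mE chi1P chi2P chi1_5 AE kE S_neq0.
  rewrite mulrC in c1E.
  have [x x_odd x_sol] : exists2 x, oddz x & (2 ^+ d %| cc c3 x)%Z.
    exact: (S_neq0_sol m_ge3 n_gt0 mE le_dN chi1P chi2P chi1_5 chi2_5 c1E c2_odd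
             AE kE A1_odd k1_odd B_odd RinvP S_neq0).
  split; last 1 first.
  - move=> big; exists x; rewrite x0P; split=> //.
    by rewrite (ME big) (CE c3) // dvdz_pow2_shift.
  - exists c3; split=> //; rewrite -/(oddz c3).
    have [d0|d_gt0] := posnP d; last first.
      exact: (sol_c3_oddz m_ge3 n_gt0 c2_odd AE A1_odd k1_odd B_odd RinvP d_gt0
               x_odd x_sol).
    (* When [d = 0], the range of [c1] leaves only [c3 = 1]. *)
    have mE0 : (m - 2 = n + t)%N.
      move: bigE mE le_t; rewrite d0; move: (odd _) => b; clear.
      by case: ifP => big; [case=> ? ?|move=> ->]; move: big; lia.
    move: c1_bound; rewrite c1E mE0; have := exprn_gt0 (n + t) (isT : 0 < 2 :> int).
    move: (2 ^+ (n + t)) => P P_gt0 /andP[ge1 leP].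
    have c3_le : c3 <= 1 by rewrite -(ler_pM2l P_gt0) mulr1.
    have c3_gt0 : 0 < c3 by rewrite -(pmulr_rgt0 _ P_gt0) (lt_le_trans _ ge1).
    by rewrite /oddz; move: c3_le c3_gt0; clear; lia.
  by move=> k_even; exact: S_neq0_chiN1 S_neq0 k_even.
have c3_o : oddz c3 := c3_odd.
have small_even : J = 0%N -> ~~ odd k -> S =
    if (2 ^+ d %| cc c3 1)%Z then 2 ^+ (m - 1) * chi2 (A + B) else 0.
  move=> J0 k_even.
  exact: (S_small_even m_ge3 n_gt0 mE le_dN chi1P chi2P chi1_5 chi2_5 c1E c2_odd
           AE kE A1_odd k1_odd B_odd RinvP J0 k_even (chi1N k_even)).
have small_odd : J = 0%N -> odd k -> S = 2 ^+ (m - 2) *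
    ((if (2 ^+ d %| cc c3 1)%Z then chi2 (A + B) else 0)
     + (if (2 ^+ d %| cc c3 (-1))%Z then chi1 (-1) * chi2 (- A + B) else 0)).
  move=> J0 k_odd.
  exact: (S_small_odd m_ge3 n_gt0 mE le_dN chi1P chi2P chi1_5 chi2_5 c1E c2_odd
           AE kE A1_odd k1_odd B_odd RinvP J0 k_odd).
have cc_even (x : int) : oddz x -> (2 %| cc c3 x)%Z.
  move=> x_odd; rewrite (_ : (2 %| cc c3 x)%Z = oddz c3) //.
  exact: (cc_oddE k c3 m_ge3 n_gt0 c2_odd AE A1_odd k1_odd B_odd RinvP x_odd).
have J0 : (m - n <= 2 * t + 4)%N -> J = 0%N.
  by move=> le_mn; move: bigE; rewrite ifF // ltnNge le_mn.
split.
- move=> big x0 lam; rewrite x0P => x0_odd Cx0 h.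
  rewrite big in bigE; case: bigE => J_gt0 Jd.
  have ccE : cc c3 x0 = lam * 2 ^+ d.
    apply: (mulfI (pow2_neq0 (n + t))); rewrite -(CE c3) // Cx0 (ME big) exprD.
    by rewrite mulrCA.
  have x0_sol : (2 ^+ d %| cc c3 x0)%Z by rewrite ccE dvdz_mull.
  have le_Nd : (J + t + 2 <= d.+1)%N by rewrite Jd -addn1 leq_add2l leq_b1.
  (* The first two terms of [h] are even, and the last is odd because [n > 0]. *)
  have h_odd : oddz h.
    have : odd `|k1%:Z|%N by [].
    have : oddz (2 ^+ n * c3 - c3).
      have : (2 %| 2 ^+ n * c3)%Z by rewrite dvdz_mulr // dvd2_exp.
      by move: c3_o; rewrite /oddz; move: (_ * c3); clear; lia.
    rewrite /h mulrBl mul1r /oddz; move: (_ - c3) => u; clear; lia.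
  case: ifP => mn_odd; rewrite mn_odd /= in Jd.
    rewrite addn1 in Jd.
    have -> : S = _ := S_big_odd m_ge3 n_gt0 mE le_dN chi1P chi2P chi1_5 chi2_5 c1E
       c2_odd AE kE A1_odd k1_odd B_odd RinvP J_gt0 le_Nd x0_odd x0_sol chi1N Jd.
    rewrite (f_half_step m_ge3 n_gt0 mE chi1P chi2P chi1_5 chi2_5 c1E
       c2_odd AE kE A1_odd k1_odd B_odd RinvP J_gt0 le_Nd x0_odd Jd ccE).
    have -> : (m + n = (n + d).*2.+1)%N by rewrite mE Jd; clear; lia.
    rewrite exprSr rmorphM /= sqrt2X -/h.
    have := omega_jacobi R h_odd; set s := (Num.sqrt 2)%:C%C => sE.
    have -> : (n + d + t + minn 1 t = (n + d) + (t + minn 1 t))%N by rewrite addnA.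
    rewrite [2 ^+ (n + d + _)]exprD.
    transitivity (2 ^+ (n + d) * 2 ^+ (t + minn 1 t)
       * (chi1 x0 * chi2 (A * x0 ^+ k + B)) * (1 + e_ R 4 h)); first by ring.
    by rewrite -sE; ring.
  rewrite addn0 in Jd.
  have -> : S = _ := S_big_even m_ge3 n_gt0 mE le_dN chi1P chi2P chi1_5 chi2_5 c1E
     c2_odd AE kE A1_odd k1_odd B_odd RinvP J_gt0 le_Nd x0_odd x0_sol chi1N (esym Jd).
  have -> : (m + n = (n + (J + t + 2)).*2)%N by rewrite mE -Jd; clear; lia.
  by rewrite sqrt2X mulr1 -addnA exprD; ring.
- move=> gt_t /J0 J0'; have {}mE : (m = n + (t + 2) + d)%N by rewrite mE J0'.
  have C_dvd x : (2 ^+ (m - 2) %| C x)%Z = (2 ^+ d %| cc c3 x)%Z.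
    rewrite (CE c3) // (_ : m - 2 = n + t + d)%N ?dvdz_pow2_shift //.
    by rewrite mE; clear; lia.
  (* For odd [k] this range forces [d = 2]. Both [cc 1] and [cc (-1)] are even with sum [2 c3 B],
     which is 2 modulo 4, so exactly one of them is divisible by 4. *)
  have excl : odd k -> (2 ^+ d %| cc c3 (-1))%Z = ~~ (2 ^+ d %| cc c3 1)%Z.
    move=> k_odd; have t0 : t = 0%N by apply/eqP; rewrite -kodd.
    have -> : d = 2%N by move: gt_t le_dN; rewrite mE J0' t0; clear; lia.
    have -> : cc c3 (-1) = 2 * c3 * B - cc c3 1.
      exact: (cc_oppE t k1 J A A1 B c2 c3 Rinv 1 k_odd).
    have : oddz (c3 * B) by rewrite oddzM c3_o.
    have := cc_even 1 isT; rewrite -mulrA /oddz; move: (c3 * B) (cc c3 1).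
    by clear; lia.
  rewrite !C_dvd; split.
  + by move=> k_even dvd1; rewrite small_even // dvd1.
  + by move=> k_odd dvd1; rewrite small_odd // excl // dvd1 addr0.
  + move=> k_odd dvdN; rewrite small_odd // dvdN.
    by move: dvdN; rewrite excl // => /negPf ->; rewrite add0r mulrA.
  move=> none; have [k_odd|k_even] := boolP (odd k).
    rewrite small_odd // !ifF ?addr0 ?mulr0 //; apply/negbTE/negP => dvd.
      by apply: none; constructor 3.
    by apply: none; constructor 2.
  rewrite small_even // ifF //; apply/negbTE/negP => dvd.
  by apply: none; constructor 1.
- move=> mn; have J0' : J = 0%N by apply: J0; rewrite mn; clear; lia.
  have d1 : d = 1%N by move: mE mn; rewrite J0'; clear; lia.
  (* Since [c1 = 2^(m-3) c3] with [c3] odd, the value is [e_2(c3) = -1], which rules out the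
     vanishing case. *)
  have chi1_5N : chi1 5 = -1.
    rewrite chi1_5 c1E (_ : n + t = m - 2 - 1)%N.
      rewrite e_scale2; first by rewrite e_2 ifN.
      by move: m_ge3; clear; lia.
    by rewrite mE J0' d1; clear; lia.
  rewrite d1 in small_even small_odd; rewrite !cc_even // in small_even small_odd.
  split.
  + by move=> k_even _ _; rewrite small_even.
  + by move=> k_odd _; rewrite small_odd.
  move=> none; case: none; have [k_odd|k_even] := boolP (odd k).
    by right; split=> //; right.
  by left; split=> //; split; [right|exact: chi1N].
move=> mn; have J0' : J = 0%N by apply: J0; rewrite mn; clear; lia.
have d0 : d = 0%N by move: mE mn; rewrite J0'; clear; lia.
rewrite d0 in small_even small_odd; rewrite !dvd1z in small_even small_odd.
have chi1_51 : chi1 5 = 1.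
  rewrite chi1_5 c1E; apply/eqP; rewrite e_pow2_eq1 (_ : m - 2 = n + t)%N.
    exact: dvdz_mulr.
  by rewrite mE J0' d0; clear; lia.
(* Here [m = n + 2], so [2 A = 2^(m-1) A1] and [chi_half] applies. For odd [k] the sum is then
   [2^(m-2) chi2(A + B) (1 - chi1(-1))]. *)
have chi2_opp : odd k -> chi2 (- A + B) = - chi2 (A + B).
  move=> k_odd; have t0 : t = 0%N by apply/eqP; rewrite -kodd.
  have -> : - A + B = (A + B) + 2 ^+ m.-1 * (- A1).
    have -> : m.-1 = n.+1 by rewrite mE J0' d0 t0; clear; lia.
    by rewrite AE exprS; ring.
  apply: (chi_half m_ge3 chi2P chi2_5) => //; last first.
    by move: A1_odd; rewrite /oddz; clear; lia.
  by have := YP 1; rewrite expr1n mulr1.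
have m1 : (m - 1 = (m - 2).+1)%N by move: m_ge3; clear; lia.
split.
  case=> [[k_even _]|[k_odd chi1E]]; first by rewrite small_even.
  rewrite small_odd // chi2_opp // chi1E m1 exprSr.
  by rewrite (_ : chi4 R (-1) = -1) //; ring.
move=> none; have [k_odd|k_even] := boolP (odd k).
  rewrite small_odd // chi2_opp //; have [-> | chi1N1] := chiN1 chi1P.
    by rewrite mul1r subrr mulr0.
  (* With [chi1 5 = 1] and [chi1 (-1) = -1], the character can only be [chi4]. *)
  case: none; right; split=> // x; rewrite /chi4.
  have [x_even|x_odd] := ifPn; first by rewrite (chi_even chi1P).
  have [b -> x4] := chi_sign m_ge3 chi1P chi1_51 x_odd; rewrite chi1N1.
  rewrite eqz_mod_dvd; case: b x4 => x4.
    by rewrite expr1 ifF //; move: x4; rewrite expr1; clear; lia.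
  by rewrite expr0 ifT //; move: x4; rewrite expr0.
case: none; left; split=> // x; rewrite /chi0.
have [x_even|x_odd] := ifPn; first by rewrite (chi_even chi1P).
have [b -> _] := chi_sign m_ge3 chi1P chi1_51 x_odd.
by rewrite (chi1N k_even) expr1n.
Qed.
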